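(* Let $T=T_N\to\infty$ as $N\to\infty$ with $\log T\sim N^{\zeta}$ for some $0<\zeta<1$, and let $0<\epsilon<1$. Let $X^n_t\sim{\rm N}(\mu^n_t,1)$ be independent, $1\le t\le T$, $1\le n\le N$. Under any one of the following conditions on $(\Delta,V,h)$, there is no algorithm (sequence of tests of $H_0:\boldsymbol{\mu}\in\Omega_0$ versus $H_1:\boldsymbol{\mu}\in\Omega_1(\Delta,V,h)$ based on the data) that achieves, as $N\to\infty$, $$\sup_{\boldsymbol{\mu}\in\Omega_0}P_{\boldsymbol{\mu}}(\text{Type I error})+\sup_{\boldsymbol{\mu}\in\Omega_1(\Delta,V,h)}P_{\boldsymbol{\mu}}(\text{Type II error})\to0 .$$ (a) $\Delta>0$ is fixed, and either (i) $V=o\big(\tfrac{\log T}{\log N}\big)$ and $h=4(1-\epsilon)\big(\tfrac{\log T}{\Delta^2V}\big)$; or (ii) $V\sim N^{1-\beta}$ for some $\tfrac{1-\zeta}{2}<\beta<1-\zeta$ and $h=4(1-\epsilon)\rho_Z(\beta,\zeta)\big(\tfrac{\log N}{\Delta^2}\big)$. (b) $\Delta=T^{-\eta}$ for some $0<\eta<\tfrac12$, and either (i) $V=o\big(\tfrac{\log T}{\log N}\big)$ and $h=4(1-2\eta)(1-\epsilon)\big(\tfrac{\log T}{\Delta^2V}\big)$; or (ii) $V\sim N^{1-\beta}$ for some $\tfrac{1-\zeta}{2}<\beta<1-\zeta$ and $h=4(1-\epsilon)\rho_Z(\beta,\zeta)\big(\tfrac{\log N}{\Delta^2}\big)$.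
   Context: $\boldsymbol{\mu}=(\mu^n_t:1\le t\le T,1\le n\le N)$ is the array of means and $P_{\boldsymbol{\mu}}$ is the corresponding probability. The set of change-points is $\boldsymbol{\tau}=\{t:\mu^n_t\ne\mu^n_{t+1}\text{ for some }n\}=\{\tau_1<\cdots<\tau_J\}$, $J=\#\boldsymbol{\tau}$, with the convention $\tau_0=0$, $\tau_{J+1}=T$. Here $V=V_N$ is a positive integer (a number of sequences). Let $$m_{j\Delta}=\#\{n:|\mu^n_{\tau_j+1}-\mu^n_{\tau_j}|\ge\Delta\},\qquad \Omega_0=\{\boldsymbol{\mu}:J=0\},$$ $$\Omega_1(\Delta,V,h)=\{\boldsymbol{\mu}:\text{there exists }1\le j\le J\text{ such that }\min(\tau_j-\tau_{j-1},\tau_{j+1}-\tau_j)\ge h\text{ and }m_{j\Delta}\ge V\}.$$ A Type I error is concluding $H_1$ when $H_0$ is true; a Type II error is concluding $H_0$ when $H_1$ is true. Finally $$\rho_Z(\beta,\zeta)=\begin{cases}\beta-\tfrac{1-\zeta}{2} & \text{if }\tfrac{1-\zeta}{2}<\beta\le\tfrac{3(1-\zeta)}{4},\\ (\sqrt{1-\zeta}-\sqrt{1-\zeta-\beta})^2 & \text{if }\tfrac{3(1-\zeta)}{4}<\beta<1-\zeta.\end{cases}$$ $a_N\sim b_N$ means $a_N/b_N\to1$. *)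

(* Defs.v *)
From HB Require Import structures.
From mathcomp Require Import all_boot all_order all_algebra.
From mathcomp Require Import all_classical all_reals all_analysis.
Set Implicit Arguments.
Unset Strict Implicit.
Unset Printing Implicit Defensive.
Import Order.TTheory GRing.Theory Num.Theory.
Import numFieldNormedType.Exports.
Local Open Scope classical_set_scope.
Local Open Scope ring_scope.

Section product_probability.
Context {R : realType} {d : measure_display} {X : measurableType d}.

Definition tuple_cons n (p : X * n.-tuple X) : n.+1.-tuple X :=
  [tuple of p.1 :: p.2].

Lemma measurable_tuple_cons n :
  measurable_fun [set: X * n.-tuple X] (@tuple_cons n).
Proof. exact: measurable_cons. Qed.

HB.instance Definition _ n :=
  isMeasurableFun.Build _ _ _ _ (@tuple_cons n) (@measurable_tuple_cons n).

(* The joint law of n independent X-valued variables with laws P i; it is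
   characterized by product_probE, since boxes generate the sigma-algebra of
   n.-tuple X. *)
Fixpoint product_prob n :
    ('I_n -> probability X R) -> probability (n.-tuple X) R :=
  match n with
  | 0 => fun=> dirac ([tuple] : 0.-tuple X)
  | m.+1 => fun P =>
      distribution (P ord0 \x product_prob (fun i => P (lift ord0 i)))%E
        (@tuple_cons m)
  end.

Lemma measurable_box n (A : 'I_n -> set X) :
  (forall i, measurable (A i)) ->
  measurable [set x : n.-tuple X | forall i, A i (tnth x i)].
Proof.
move=> mA.
have -> : [set x : n.-tuple X | forall i, A i (tnth x i)] =
    \bigcap_(i in [set: 'I_n]) ((fun x : n.-tuple X => tnth x i) @^-1` A i).
  by apply/seteqP; split=> x /= Ax i; [move=> _; exact: Ax | exact: Ax i I].
apply: fin_bigcap_measurable => [|i _]; first exact: finite_finset.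
by rewrite -[X in measurable X]setTI; exact: measurable_tnth.
Qed.

Lemma product_probE n (P : 'I_n -> probability X R) (A : 'I_n -> set X) :
  (forall i, measurable (A i)) ->
  product_prob P [set x | forall i, A i (tnth x i)] =
  (\prod_(i < n) P i (A i))%E.
Proof.
elim: n P A => [|n IH] P A mA.
  rewrite big_ord0 /= diracE mem_set//= => -[].
  by [].
have mA' i : measurable (A (lift ord0 i)) by exact: mA.
rewrite big_ord_recl /= /distribution /pushforward -(IH _ _ mA').
rewrite -product_measure1E; [|exact: mA|exact: (measurable_box mA')].
congr (_ _); apply/seteqP; split=> -[a x] /=.
  move=> H; split; first exact: (H ord0).
  by move=> i; move: (H (lift ord0 i)); rewrite tnthS.
move=> [Ha Hx] i; case: (unliftP ord0 i) => [j|] ->//.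
by rewrite tnthS; exact: Hx.
Qed.

End product_probability.

Section change_points.
Context {R : realType} {T N : nat}.
Implicit Types (mu : 'M[R]_(T, N)) (n : 'I_N) (t j : nat).

(* Row i of mu holds the means at time i + 1, so that times t range over
   1, ..., T; values of t outside this range are never used. *)
Definition mean mu t n : R := oapp (mu ^~ n) 0 (insub t.-1 : option 'I_T).

Definition change_points mu : seq nat :=
  [seq t <- iota 1 T.-1 | [exists n, mean mu t n != mean mu t.+1 n]].

Definition num_change_points mu : nat := size (change_points mu).

(* tau mu 0 = 0 and, for j > num_change_points mu, tau mu j = T. *)
Definition tau mu j : nat := nth T (0%N :: change_points mu) j.

Definition jump_count mu j (Delta : R) : nat :=
  #|[pred n : 'I_N |
      Delta <= `|mean mu (tau mu j).+1 n - mean mu (tau mu j) n| ]|.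

Definition Omega0 : set 'M[R]_(T, N) :=
  [set mu | num_change_points mu = 0%N].

Definition Omega1 (Delta : R) (V : nat) (h : R) : set 'M[R]_(T, N) :=
  [set mu | exists j : nat,
    [/\ (1 <= j <= num_change_points mu)%N,
        h <= (minn (tau mu j - tau mu j.-1) (tau mu j.+1 - tau mu j))%:R &
        (V <= jump_count mu j Delta)%N] ].

End change_points.
Arguments Omega0 R T N : clear implicits.
Arguments Omega1 {R} T N Delta V h.

(* The observation at time i + 1 in sequence k + 1 is tnth (tnth x i) k. *)
Notation data R T N := (T.-tuple (N.-tuple (measurableTypeR R))).

Section testing.
Context {R : realType} (T N : nat).

Definition data_law (mu : 'M[R]_(T, N)) : probability (data R T N) R :=
  product_prob (fun t => product_prob (fun n => normal_prob (mu t n) 1)).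

Definition test : Type := {mfun data R T N >-> bool}.

End testing.
Arguments test R T N : clear implicits.

Lemma data_lawE (R : realType) (T N : nat) (mu : 'M[R]_(T, N))
    (A : 'I_T -> 'I_N -> set (measurableTypeR R)) :
  (forall t n, measurable (A t n)) ->
  data_law mu [set x | forall t n, A t n (tnth (tnth x t) n)] =
  (\prod_(t < T) \prod_(n < N) normal_prob (mu t n) 1 (A t n))%E.
Proof.
move=> mA; have mbox t := measurable_box (mA t).
rewrite /data_law (product_probE _ mbox).
by apply: eq_bigr => t _; rewrite (product_probE _ (mA t)).
Qed.

Section errors.
Context {R : realType} (T N : nat) (psi : test R T N).

(* psi x = true means that H_1 is concluded from the data x. *)
Definition type1_error (mu : 'M[R]_(T, N)) : R :=
  fine (data_law mu (psi @^-1` [set true])).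

Definition type2_error (mu : 'M[R]_(T, N)) : R :=
  fine (data_law mu (psi @^-1` [set false])).

(* The supremum over an empty Omega1 is 0 here, by the convention for sup. *)
Definition total_error (Delta : R) (V : nat) (h : R) : R :=
  sup [set type1_error mu | mu in Omega0 R T N] +
  sup [set type2_error mu | mu in Omega1 T N Delta V h].

End errors.

Section asymptotics.
Context {R : realType}.

Definition asymp_equiv (a b : nat -> R) : Prop :=
  (fun N => a N / b N) @ \oo --> (1 : R).

(* Only meant for (1 - zeta) / 2 < beta < 1 - zeta. *)
Definition rho_Z (beta zeta : R) : R :=
  if beta <= 3 * (1 - zeta) / 4 then beta - (1 - zeta) / 2
  else (Num.sqrt (1 - zeta) - Num.sqrt (1 - zeta - beta)) ^+ 2.

End asymptotics.

(* Main.v *)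
Require Import Defs.
From HB Require Import structures.
From mathcomp Require Import all_boot all_order all_algebra.
From mathcomp Require Import all_classical all_reals all_analysis.
Import Order.TTheory GRing.Theory Num.Theory.
Import numFieldNormedType.Exports.
From mathcomp Require Import measurable_realfun.
From mathcomp Require Import ring lra zify.
Local Open Scope classical_set_scope.
Local Open Scope ring_scope.

(** No test succeeds because the null cannot be told from a well chosen mixture
of alternatives.

Cut the time axis into K = T / 2H disjoint windows of length 2H, where H is h
rounded up. Under the null all means are 0. Under the prior on alternatives a
window is drawn uniformly, each sequence n is affected independently with
probability p n, and an affected sequence has mean - Delta / 2 on the first
half of the window and Delta / 2 on the second. The centre of the window is
then a change-point of size Delta at distance H from its neighbours, and the
squared norm of the signal in one sequence is Q = H Delta ^ 2 / 2. The choice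
of p makes at least V sequences affected with probability at least 1 / 2
(weight_few_le).

Let L be the likelihood ratio of this prior against the null. For lam > 0 and
s > 0, L is at most lam + lam ^ - s L ^ (1 + s), so a test whose type I error
vanishes cannot have a small average type II error as soon as L has a bounded
moment of order 1 + s under the null (mixture_le_level, bayes_bound).
Taking s in ]0, 1] rather than s = 1 is what makes the constants sharp: it
plays the part of a truncation of L.

L is the mean of K factors L_k, one per window, with E L_k = 1 and
E L_k L_l = 1 for distinct windows. Subadditivity of the power s and its
tangent at 1 give E L ^ (1 + s) <= 1 + K ^ - s max_k E L_k ^ (1 + s)
(dominated_mixture_powR). Inside a window, L_k is a product over sequences of
mixtures 1 - q + q Y with Y a Gaussian likelihood ratio, and the same two facts
give E (1 - q + q Y) ^ (1 + s) <= 1 + q ^ (1 + s) exp (s (1 + s) Q / 2)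
(mixture_powR_le). All these bounds hold pointwise, against nonnegative
combinations of likelihood ratios of single mean arrays, each of which has
integral 1; the measure theory thus reduces to the density of a product of
Gaussian laws (product_density).

What remains is to make the product over n of
1 + p n ^ (1 + s) exp (s (1 + s) Q / 2) at most K ^ s (minimax_bound). With
Delta = D0 T ^ - eta one has log K ~ (1 - 2 eta) log T; a fixed Delta is the
case eta = 0.
- If V = o (log T / log N), affect V given sequences. Their signals have
  s (1 + s) V Q / 2 = s (1 + s) (1 - 2 eta) (1 - eps) log T up to lower order
  terms, which is below s log K when s = eps / 2 (sparse_undetectable).
- If V ~ N ^ (1 - beta), let p n = 4 V / N. With h = 4 r log N / Delta ^ 2 the
  logarithm of the product is of order N ^ (1 - (1 + s) (beta - r s)), which
  has to be o (N ^ zeta). So r is admissible when (1 + s) (beta - r s) exceeds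
  1 - zeta for some s, and the supremum of such r is rho_Z: its first branch
  corresponds to s = 1 and its second to an interior maximum
  (rho_Z_exponent, moderate_undetectable). *)
Set Implicit Arguments.
Unset Strict Implicit.
Unset Printing Implicit Defensive.

(** * Densities of product laws *)

Section density.
Context {R : realType}.

(** The formulation by integrals of nonnegative functions, rather than by
measures of sets, is the one that passes through iterated integrals. *)
Definition has_density {d} {X : measurableType d} (P Q : probability X R)
    (g : X -> R) : Prop :=
  [/\ measurable_fun [set: X] g, forall x, 0 <= g x &
      forall f : X -> \bar R, measurable_fun setT f ->
        (forall x, 0 <= f x)%E ->
        (\int[Q]_x f x = \int[P]_x (f x * (g x)%:E))%E].

(** The normal density is a Radon-Nikodym derivative of the normal law, which
is unique up to a null set; the change of variables for the derivative then
holds for the explicit density. *)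
Lemma ge0_integral_normal_prob (m : R) (f : measurableTypeR R -> \bar R) :
  measurable_fun setT f -> (forall x, 0 <= f x)%E ->
  (\int[normal_prob m 1]_x f x =
   \int[lebesgue_measure]_x (f x * (normal_pdf m 1 x)%:E))%E.
Proof.
move=> mf f0; have dom := normal_prob_dominates m (1 : R).
rewrite -(Radon_Nikodym_SigmaFinite.change_of_variables dom)//.
have fin := Radon_Nikodym_SigmaFinite.f_integrable dom.
have mfin := measurable_int _ fin.
have mpdf : measurable_fun [set: measurableTypeR R]
    (fun x => (normal_pdf m 1 x)%:E).
  by apply/measurable_EFinP; exact: measurable_normal_pdf.
apply: ge0_ae_eq_integral => //.
- exact: emeasurable_funM.
- exact: emeasurable_funM.
- by move=> x _; rewrite mule_ge0// Radon_Nikodym_SigmaFinite.f_ge0.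
- by move=> x _; rewrite mule_ge0// lee_fin normal_pdf_ge0.
apply: ae_eqe_mul2l; apply: integral_ae_eq => //.
by move=> A _ mA; rewrite -Radon_Nikodym_SigmaFinite.f_integral.
Qed.

Lemma normal_density (m : R) :
  has_density (normal_prob 0 1 : probability (measurableTypeR R) R)
    (normal_prob m 1) (fun x => expR (m * x - m ^+ 2 / 2)).
Proof.
have mg : measurable_fun [set: measurableTypeR R]
    (fun x : measurableTypeR R => expR (m * x - m ^+ 2 / 2)).
  apply: measurableT_comp => //; apply: measurable_funB => //.
split; [exact: mg|by move=> x; exact: expR_ge0|move=> f mf f0].
have mfg : measurable_fun setT
    (fun x : measurableTypeR R => f x * (expR (m * x - m ^+ 2 / 2))%:E)%E.
  by apply: (emeasurable_funM mf); exact/measurable_EFinP.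
have fg0 (x : measurableTypeR R) :
    (0 <= f x * (expR (m * x - m ^+ 2 / 2))%:E)%E.
  by apply: mule_ge0; [exact: f0|rewrite lee_fin expR_ge0].
transitivity (\int[lebesgue_measure]_x (f x * (normal_pdf m 1 x)%:E))%E.
  exact: (ge0_integral_normal_prob m mf f0).
apply/esym; apply: etrans (ge0_integral_normal_prob 0 mfg fg0) _.
apply: eq_integral => x _; rewrite -muleA -EFinM; congr (_ * _%:E)%E.
rewrite !normal_pdfE ?oner_eq0// /normal_fun mulrCA -expRD.
congr (_ * expR _).
by rewrite !expr1n !subr0; field.
Qed.

Context {d} {X : measurableType d}.

Lemma ge0_integral_product_probS n (P : 'I_n.+1 -> probability X R)
    (f : n.+1.-tuple X -> \bar R) :
  measurable_fun setT f -> (forall x, 0 <= f x)%E ->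
  (\int[product_prob P]_x f x =
   \int[P ord0]_a \int[product_prob (fun i => P (lift ord0 i))]_y
     f (tuple_cons (a, y)))%E.
Proof.
move=> mf f0; rewrite /= ge0_integral_pushforward//= fubini_tonelli1//.
by apply: measurableT_comp => //; exact: measurable_tuple_cons.
Qed.

(** By Tonelli, one coordinate at a time: the inner integral is changed by the
induction hypothesis and the outer one by the density of the first factor. *)
Lemma product_density n (P Q : 'I_n -> probability X R) (g : 'I_n -> X -> R) :
  (forall i, has_density (P i) (Q i) (g i)) ->
  has_density (product_prob P) (product_prob Q)
    (fun x => \prod_(i < n) g i (tnth x i)).
Proof.
elim: n P Q g => [|n IH] P Q g dPQ.
  split=> [|x|f mf f0].
  - under eq_fun do rewrite big_ord0; exact: measurable_cst.
  - by rewrite big_ord0.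
  - by apply: eq_integral => x _; rewrite big_ord0 mule1.
have mg : measurable_fun [set: n.+1.-tuple X]
    (fun x => \prod_(i < n.+1) g i (tnth x i)).
  apply: measurable_prod => i _; apply: measurableT_comp => //.
  - by case: (dPQ i).
  - exact: measurable_tnth.
have g0 (x : n.+1.-tuple X) : 0 <= \prod_(i < n.+1) g i (tnth x i).
  by apply: prodr_ge0 => i _; case: (dPQ i).
split=> // f mf f0.
have [mt t0 It] := IH _ _ _ (fun i => dPQ (lift ord0 i)).
have [m0 g00 I0] := dPQ ord0.
have mfc : measurable_fun [set: X * n.-tuple X] (f \o @tuple_cons _ X n).
  by apply: measurableT_comp => //; exact: measurable_tuple_cons.
rewrite !ge0_integral_product_probS//; last 2 first.
- by apply: emeasurable_funM => //; exact/measurable_EFinP.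
- by move=> x; rewrite mule_ge0// lee_fin.
pose F a := (\int[product_prob (fun i => P (lift ord0 i))]_y
  (f (tuple_cons (a, y)) * (\prod_(i < n) g (lift ord0 i) (tnth y i))%:E))%E.
have mF2 : measurable_fun [set: X * n.-tuple X] (fun z : X * n.-tuple X =>
    f (tuple_cons z) * (\prod_(i < n) g (lift ord0 i) (tnth z.2 i))%:E)%E.
  apply: emeasurable_funM => //; apply/measurable_EFinP.
  exact: (measurableT_comp mt).
transitivity (\int[Q ord0]_a F a)%E.
  apply: eq_integral => a _; rewrite It//.
  by apply: (measurableT_comp mfc); exact: pair1_measurable.
rewrite I0; last 2 first.
- have F20 (z : X * n.-tuple X) :
      (0 <= f (tuple_cons z) *
        (\prod_(i < n) g (lift ord0 i) (tnth z.2 i))%:E)%E.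
    by rewrite mule_ge0// lee_fin.
  exact: (@measurable_fun_fubini_tonelli_F _ _ _ _ _
    (product_prob (fun i => P (lift ord0 i))) _ mF2 F20).
- by move=> a; apply: integral_ge0 => y _; rewrite mule_ge0// lee_fin.
apply: eq_integral => a _; rewrite muleC -ge0_integralZl//; last 3 first.
- by apply: (measurableT_comp mF2); exact: pair1_measurable.
- by move=> y _; rewrite mule_ge0// lee_fin.
- by rewrite lee_fin.
apply: eq_integral => y _; rewrite muleCA -EFinM big_ord_recl.
congr (_ * _%:E)%E.
by under [in RHS]eq_bigr do rewrite tnthS.
Qed.

End density.

(** * Likelihood ratios and domination *)

Section likelihood_ratio.
Context {R : realType} {T N : nat}.
Implicit Types mu nu : 'M[R]_(T, N).

Definition lr mu (x : data R T N) : R :=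
  \prod_(t < T) \prod_(n < N)
    expR (mu t n * tnth (tnth x t) n - mu t n ^+ 2 / 2).

Lemma lr_density mu : has_density (data_law 0) (data_law mu) (lr mu).
Proof.
apply: (product_density
  (P := fun t => product_prob (fun n => normal_prob _ 1))
  (g := fun t (row : N.-tuple (measurableTypeR R)) => \prod_(n < N)
    expR (mu t n * tnth row n - mu t n ^+ 2 / 2))) => t.
apply: (product_density (P := fun n => normal_prob _ 1)
  (g := fun n (y : measurableTypeR R) =>
    expR (mu t n * y - mu t n ^+ 2 / 2))) => n.
by rewrite mxE; exact: normal_density.
Qed.

Lemma lr_ge0 mu x : 0 <= lr mu x.
Proof. by have [_ + _] := lr_density mu; apply. Qed.

Lemma measurable_lr mu : measurable_fun setT (lr mu).
Proof. by have [] := lr_density mu. Qed.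

Lemma data_law_lr mu (A : set (data R T N)) : measurable A ->
  data_law mu A = (\int[data_law 0]_(x in A) (lr mu x)%:E)%E.
Proof.
move=> mA; have [_ _ I] := lr_density mu.
have := integral_indic (data_law mu) measurableT mA.
rewrite setIT => <-; rewrite I; last 2 first.
- by apply/measurable_EFinP; exact: measurable_indic.
- by move=> x; rewrite lee_fin.
rewrite [RHS]integral_mkcond; apply: eq_integral => x _.
by rewrite patchE indicE; case: (x \in A); rewrite ?mul1e ?mul0e.
Qed.

Lemma lrE mu x : lr mu x = expR (\sum_(t < T) \sum_(n < N)
    (mu t n * tnth (tnth x t) n - mu t n ^+ 2 / 2)).
Proof. by rewrite expR_sum; apply: eq_bigr => t _; rewrite expR_sum. Qed.

(** The cross term of (mu + nu) ^ 2 vanishes. Since every lr has integral 1,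
this is where the independence of disjoint windows enters. *)
Lemma lrM mu nu x : (forall t n, mu t n * nu t n = 0) ->
  lr mu x * lr nu x = lr (mu + nu) x.
Proof.
move=> munu; rewrite !lrE -expRD -big_split; congr expR.
apply: eq_bigr => t _; rewrite -big_split; apply: eq_bigr => n _ /=.
by rewrite mxE sqrrD munu mul0rn; ring.
Qed.

(** An upper bound c on the integral of f under the null, stated through a
majorant so that every estimate below is a pointwise inequality. *)
Definition dominated (f : data R T N -> R) (c : R) : Prop :=
  exists g : data R T N -> R,
    [/\ measurable_fun setT g, forall x, 0 <= g x, forall x, f x <= g x &
        (\int[data_law 0]_x (g x)%:E <= c%:E)%E].

Lemma dominated_lr mu : dominated (lr mu) 1.
Proof.
exists (lr mu); split=> //; [exact: measurable_lr|exact: lr_ge0|].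
by rewrite -data_law_lr// probability_setT.
Qed.

Lemma dominated_le f g c c' : (forall x, f x <= g x) -> c <= c' ->
  dominated g c -> dominated f c'.
Proof.
move=> fg cc' [h [mh h0 gh Ih]]; exists h; split=> // [x|].
  exact: le_trans (gh x).
by rewrite (le_trans Ih)// lee_fin.
Qed.

Lemma dominatedD f g c c' : dominated f c -> dominated g c' ->
  dominated (fun x => f x + g x) (c + c').
Proof.
move=> [h [mh h0 fh Ih]] [k [mk k0 gk Ik]]; exists (fun x => h x + k x).
split=> [|x|x|]; [exact: measurable_funD|exact: addr_ge0|exact: lerD|].
under eq_integral do rewrite EFinD.
rewrite ge0_integralD//; last 4 first.
- by move=> x _; rewrite lee_fin.
- exact/measurable_EFinP.
- by move=> x _; rewrite lee_fin.
- exact/measurable_EFinP.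
by rewrite EFinD leeD.
Qed.

Lemma dominatedZ a f c : 0 <= a -> dominated f c ->
  dominated (fun x => a * f x) (a * c).
Proof.
move=> a0 [h [mh h0 fh Ih]]; exists (fun x => a * h x).
split=> [|x|x|]; [exact: measurable_funM|exact: mulr_ge0|exact: ler_wpM2l|].
under eq_integral do rewrite EFinM.
rewrite ge0_integralZl//; last 2 first.
- exact/measurable_EFinP.
- by move=> x _; rewrite lee_fin.
by rewrite EFinM lee_wpmul2l// lee_fin.
Qed.

Lemma dominated_sum (I : Type) (r : seq I) (P : pred I)
    (f : I -> data R T N -> R) (c : I -> R) :
  (forall i, P i -> dominated (f i) (c i)) ->
  dominated (fun x => \sum_(i <- r | P i) f i x) (\sum_(i <- r | P i) c i).
Proof.
move=> fc; elim: r => [|i r IH].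
  exists (fun=> 0); rewrite big_nil; split=> // [x|]; first by rewrite big_nil.
  by rewrite integral0.
rewrite big_cons; case: ifPn => Pi; last first.
  by apply: dominated_le IH => // x; rewrite big_cons (negbTE Pi).
apply: dominated_le (dominatedD (fc i Pi) IH) => // x.
by rewrite big_cons Pi.
Qed.

(** The power of a test against a mixture is small if its level is small and
the mixture ratio L has a bounded moment of order 1 + s: integrate
L <= lam + lam ^ - s L ^ (1 + s) over the rejection region A. *)
Lemma mixture_le_level (I : finType) (w : I -> R) (mu : I -> 'M[R]_(T, N))
    (A : set (data R T N)) (s c lam : R) :
  measurable A -> (forall i, 0 <= w i) -> 0 < s -> 0 < lam ->
  dominated (fun x => (\sum_i w i * lr (mu i) x) `^ (1 + s)) c ->
  \sum_i w i * fine (data_law (mu i) A) <=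
    lam * fine (data_law 0 A) + lam `^ (- s) * c.
Proof.
move=> mA w0 s0 lam0 [g [mg g0 fg Ig]].
pose L x := \sum_i w i * lr (mu i) x.
have L0 x : 0 <= L x by apply: sumr_ge0 => i _; rewrite mulr_ge0// lr_ge0.
have fine_law nu : (fine (data_law nu A))%:E = data_law nu A.
  by rewrite fineK// fin_num_measure.
have mwlr i : measurable_fun A (fun x => (w i * lr (mu i) x)%:E).
  apply/measurable_EFinP; apply: measurable_funM => //.
  by apply: measurable_funTS; exact: measurable_lr.
rewrite -lee_fin.
have -> : (\sum_i w i * fine (data_law (mu i) A))%:E =
    (\int[data_law 0]_(x in A) (L x)%:E)%E.
  under eq_integral do rewrite /L -sumEFin.
  rewrite ge0_integral_sum//; last first.
    by move=> i x _; rewrite lee_fin mulr_ge0// lr_ge0.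
  rewrite -sumEFin; apply: eq_bigr => i _; rewrite EFinM fine_law data_law_lr//.
  under [RHS]eq_integral do rewrite EFinM.
  rewrite ge0_integralZl//; last 3 first.
  - by apply/measurable_EFinP/measurable_funTS; exact: measurable_lr.
  - by move=> x _; rewrite lee_fin lr_ge0.
  - by rewrite lee_fin.
have mL : measurable_fun A (EFin \o L).
  apply/measurable_EFinP/measurable_sum => i; apply: measurable_funM => //.
  by apply: measurable_funTS; exact: measurable_lr.
(* Either L x <= lam, or (L x / lam) ^ s >= 1. *)
have pt x : L x <= lam + lam `^ (- s) * g x.
  have [Ll|lL] := leP (L x) lam.
    by rewrite (le_trans Ll)// lerDl mulr_ge0// powR_ge0.
  have Lx0 := lt_trans lam0 lL.
  apply: le_trans (_ : lam `^ (- s) * L x `^ (1 + s) <= _); last first.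
    apply: ler_wpDl; first exact: ltW.
    by apply: ler_wpM2l; [exact: powR_ge0|exact: fg].
  rewrite powRD ?(gt_eqF Lx0) ?implybT// powRr1// mulrCA ler_peMr//.
  rewrite powRN mulrC ler_pdivlMr ?powR_gt0// mul1r.
  by rewrite ge0_ler_powR ?nnegrE// ltW.
have mgA : measurable_fun A (EFin \o g).
  by apply/measurable_EFinP; exact: measurable_funTS.
apply: (@le_trans _ _ (\int[data_law 0]_(x in A)
    (lam%:E + (lam `^ (- s))%:E * (g x)%:E))%E).
  apply: ge0_le_integral => //.
  - by move=> x _; rewrite lee_fin.
  - by apply: emeasurable_funD => //; exact: measurable_funeM.
  - by move=> x _; rewrite -EFinM -EFinD lee_fin.
rewrite ge0_integralD//; last 3 first.
- by move=> x _; rewrite lee_fin ltW.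
- by move=> x _; rewrite -EFinM lee_fin mulr_ge0// powR_ge0.
- exact: measurable_funeM.
rewrite integral_cst// EFinD EFinM fine_law leeD2l//.
rewrite ge0_integralZl//; last 2 first.
- by move=> x _; rewrite lee_fin.
- by rewrite lee_fin powR_ge0.
rewrite EFinM lee_wpmul2l// ?lee_fin ?powR_ge0//.
apply: le_trans Ig; apply: ge0_subset_integral => //.
- exact/measurable_EFinP.
- by move=> x _; rewrite lee_fin.
Qed.

End likelihood_ratio.

(** * Inequalities for real powers *)

Section powers.
Context {R : realType}.
Implicit Types a b s z : R.

(** Young's inequality for z ^ s and 1, with conjugate exponents 1 / s and
1 / (1 - s). *)
Lemma powR_le_tangent z s : 0 <= z -> 0 < s <= 1 -> z `^ s <= 1 - s + s * z.
Proof.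
move=> z0 /andP[s0]; rewrite le_eqVlt => /predU1P[->|s1].
  by rewrite powRr1// subrr add0r mul1r.
have := @conjugate_powR R (z `^ s) 1 s^-1 (1 - s)^-1.
rewrite powR_ge0 ler01 !invr_gt0 s0 subr_gt0 s1 !invrK addrC subrK.
move=> /(_ isT isT isT isT erefl).
by rewrite mulr1 -powRrM divff ?gt_eqF// powRr1// powR1 mul1r addrC mulrC.
Qed.

(** Each part y of the sum c satisfies y / c <= (y / c) ^ s, because y / c is at
most 1; multiply by c ^ s and add the two parts. *)
Lemma powR_subadditive a b s : 0 <= a -> 0 <= b -> 0 < s <= 1 ->
  (a + b) `^ s <= a `^ s + b `^ s.
Proof.
move=> a0 b0 /andP[s0 s1]; have [c0|] := ltP 0 (a + b); last first.
  move=> c0; have -> : a + b = 0 by apply/eqP; rewrite eq_le c0 addr_ge0.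
  by rewrite powR0 ?gt_eqF// addr_ge0// powR_ge0.
have part y : 0 <= y <= a + b -> (y / (a + b)) * (a + b) `^ s <= y `^ s.
  move=> /andP[y0 yc]; have yc0 : 0 <= y / (a + b) by rewrite divr_ge0// ltW.
  have -> : y `^ s = (y / (a + b)) `^ s * (a + b) `^ s.
    by rewrite -powRM// ?ltW// divfK// gt_eqF.
  apply: ler_wpM2r; first exact: powR_ge0.
  move: y0; rewrite le_eqVlt => /predU1P[<-|y0].
    by rewrite mul0r powR_ge0.
  by rewrite ger1_powR// divr_gt0//= ler_pdivrMr// mul1r.
have -> : (a + b) `^ s =
    a / (a + b) * (a + b) `^ s + b / (a + b) * (a + b) `^ s.
  by rewrite -!mulrDl divff ?mul1r// gt_eqF.
by rewrite lerD// part// ?a0 ?b0 ?lerDl ?lerDr.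
Qed.

Lemma powR_expR u a : expR u `^ a = expR (a * u).
Proof. by rewrite /powR gt_eqF ?expR_gt0// expRK. Qed.

Lemma powR_prod (I : finType) (f : I -> R) s : (forall i, 0 <= f i) ->
  (\prod_i f i) `^ s = \prod_i f i `^ s.
Proof.
move=> f0; suff [] : (\prod_i f i) `^ s = \prod_i f i `^ s /\ 0 <= \prod_i f i.
  by [].
elim/big_rec2: _ => [|i y1 y2 _ [<- y0]]; first by rewrite powR1.
by rewrite powRM// mulr_ge0.
Qed.

(** With z the mixture, z ^ (1 + s) = (1 - q) z ^ s + q y z ^ s; the first power
is bounded by its tangent and the second by subadditivity. The tangent
loses nothing at first order in z - 1, so that when y has mean 1 the mean of
the right-hand side is 1 plus the mean of the last term only. *)
Lemma mixture_powR_le q y s : 0 <= q <= 1 -> 0 <= y -> 0 < s <= 1 ->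
  (1 - q + q * y) `^ (1 + s) <=
  (1 - q) * (1 - s * q) + (q + (1 - q) * (s * q)) * y +
    q `^ (1 + s) * y `^ (1 + s).
Proof.
move=> /andP[q_ge0 q_le1] y0 s01; have /andP[s0 s1] := s01.
have r0 : 0 <= 1 - q by rewrite subr_ge0.
have qy0 : 0 <= q * y by rewrite mulr_ge0.
have powS z : 0 <= z -> z `^ (1 + s) = z * z `^ s.
  move=> z0; rewrite powRD ?powRr1//.
  by rewrite gt_eqF//; lra.
have z0 : 0 <= 1 - q + q * y by exact: addr_ge0.
rewrite -powRM// !powS//.
rewrite [X in X <= _]mulrDl.
have H1 : (1 - q + q * y) `^ s <= 1 - s + s * (1 - q + q * y).
  by apply: powR_le_tangent => //; exact: addr_ge0.
have H2 : (1 - q + q * y) `^ s <= 1 + (q * y) `^ s.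
  apply: le_trans (powR_subadditive r0 qy0 s01) _.
  rewrite lerD2r; apply: (@le_trans _ _ (1 `^ s)); last by rewrite powR1.
  by apply: ge0_ler_powR; rewrite ?nnegrE//; [exact: ltW|rewrite lerBlDr lerDl].
apply: le_trans (lerD (ler_wpM2l r0 H1) (ler_wpM2l qy0 H2)) _.
by rewrite le_eqVlt; apply/orP; left; apply/eqP; ring.
Qed.

End powers.

(** * The mixture over windows and sequences *)

Section windows.
Context {R : realType} {T N K : nat}.
Variables (theta : 'I_K -> 'I_T -> R) (Q : R).
Hypothesis theta_norm : forall k, \sum_t theta k t ^+ 2 = Q.
Hypothesis theta_disj : forall k l t, k != l -> theta k t * theta l t = 0.

Definition signal (k : 'I_K) (v : 'I_N -> R) : 'M[R]_(T, N) :=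
  \matrix_(t, n) (theta k t * v n).

Definition score k n (x : data R T N) : R :=
  \sum_t theta k t * tnth (tnth x t) n.

(** The likelihood ratio of one sequence carrying v times the pattern of
window k. *)
Definition tilt k n (v : R) x : R := expR (v * score k n x - v ^+ 2 / 2 * Q).

Lemma tilt0 k n x : tilt k n 0 x = 1.
Proof. by rewrite /tilt expr0n/= !mul0r subr0 expR0. Qed.

Lemma lr_signal k v x : lr (signal k v) x = \prod_n tilt k n (v n) x.
Proof.
rewrite lrE exchange_big expR_sum; apply: eq_bigr => n _; congr expR.
rewrite -(theta_norm k) !mulr_sumr -sumrB; apply: eq_bigr => t _.
by rewrite mxE; ring.
Qed.

(** Expanding the product chooses one multiple of the pattern in every sequence,
so that a product of mixtures is a mixture of likelihood ratios. *)
Lemma prod_tilt (J : finType) k (a : 'I_N -> J -> R) (v : J -> R) x :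
  \prod_n \sum_j a n j * tilt k n (v j) x =
  \sum_(f : {ffun 'I_N -> J}) (\prod_n a n (f n)) *
    lr (signal k (fun n => v (f n))) x.
Proof.
rewrite bigA_distr_bigA; apply: eq_bigr => f _.
by rewrite big_split lr_signal.
Qed.

Lemma dominated_prod_tilt (J : finType) k (a : 'I_N -> J -> R) (v : J -> R) :
  (forall n j, 0 <= a n j) ->
  dominated (fun x => \prod_n \sum_j a n j * tilt k n (v j) x)
    (\prod_n \sum_j a n j).
Proof.
move=> a0; rewrite bigA_distr_bigA.
apply: (dominated_le (g := fun x => \sum_(f : {ffun 'I_N -> J})
  (\prod_n a n (f n)) * lr (signal k (fun n => v (f n))) x) _ (lexx _)).
  by move=> x; rewrite prod_tilt.
apply: dominated_sum => f _; rewrite -[X in dominated _ X]mulr1.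
by apply: dominatedZ; [exact: prodr_ge0|exact: dominated_lr].
Qed.

Variables (p : 'I_N -> R) (s : R).
Hypothesis p01 : forall n, 0 <= p n <= 1.
Hypothesis s01 : 0 < s <= 1.

Definition coin (n : 'I_N) (b : bool) : R := if b then p n else 1 - p n.
Definition weight (S : {ffun 'I_N -> bool}) : R := \prod_n coin n (S n).
Definition affected k (S : {ffun 'I_N -> bool}) : 'M[R]_(T, N) :=
  signal k (fun n => (S n)%:R).
(** The average of the likelihood ratio over the random set of affected
sequences, given the window. *)
Definition window_lr k x : R := \sum_S weight S * lr (affected k S) x.

Let p0 n : 0 <= p n. Proof. by have /andP[] := p01 n. Qed.
Let q0 n : 0 <= 1 - p n.
Proof. by have /andP[_] := p01 n; rewrite subr_ge0. Qed.

Lemma coin_ge0 n b : 0 <= coin n b.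
Proof. by case: b => /=. Qed.

Lemma weight_ge0 S : 0 <= weight S.
Proof. by apply: prodr_ge0 => n _; exact: coin_ge0. Qed.

Lemma sum_coin n : \sum_b coin n b = 1.
Proof. by rewrite big_bool /= addrC subrK. Qed.

Lemma sum_weight : \sum_S weight S = 1.
Proof.
by rewrite -bigA_distr_bigA big1// => n _; exact: sum_coin.
Qed.

Lemma window_lr_ge0 k x : 0 <= window_lr k x.
Proof. by apply: sumr_ge0 => S _; rewrite mulr_ge0 ?weight_ge0 ?lr_ge0. Qed.

Lemma window_lrE k x :
  window_lr k x = \prod_n (1 - p n + p n * tilt k n 1 x).
Proof.
transitivity (\prod_n \sum_b coin n b * tilt k n b%:R x).
  by rewrite (prod_tilt k coin (fun b : bool => b%:R)).
apply: eq_bigr => n _.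
by rewrite big_bool /= tilt0 mulr1 addrC.
Qed.

Lemma dominated_window_lr k : dominated (window_lr k) 1.
Proof.
rewrite -sum_weight; apply: dominated_sum => S _.
rewrite -[X in dominated _ X]mulr1.
by apply: dominatedZ; [exact: weight_ge0|exact: dominated_lr].
Qed.

Lemma dominated_window_lrM k l : k != l ->
  dominated (fun x => window_lr k x * window_lr l x) 1.
Proof.
move=> kl; have -> : 1 = \sum_S \sum_S' weight S * weight S' :> R.
  by rewrite -big_distrlr/= sum_weight mulr1.
apply: (dominated_le (g := fun x => \sum_S \sum_S'
    weight S * weight S' * lr (affected k S + affected l S') x) _ (lexx _)).
  move=> x; rewrite big_distrlr le_eqVlt; apply/orP; left; apply/eqP.
  apply: eq_bigr => S _.
  apply: eq_bigr => S' _; rewrite /= mulrACA lrM// => t n.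
  by rewrite !mxE mulrACA theta_disj// mul0r.
apply: dominated_sum => S _; apply: dominated_sum => S' _.
rewrite -[X in dominated _ X]mulr1; apply: dominatedZ; last exact: dominated_lr.
by rewrite mulr_ge0 ?weight_ge0.
Qed.

(** The null moment of order 1 + s of the likelihood ratio of one affected
sequence. *)
Definition gauss_moment : R := expR (s * (1 + s) / 2 * Q).

(** A power of a Gaussian likelihood ratio is again one, up to a constant, for
the signal multiplied by 1 + s. *)
Lemma tilt_powR k n x : tilt k n 1 x `^ (1 + s) =
  gauss_moment * tilt k n (1 + s) x.
Proof.
by rewrite powR_expR -expRD; congr expR; rewrite /tilt; field.
Qed.

(** Each factor is bounded by a combination of the ratios of the signals
multiplied by 0, 1 and 1 + s, whose coefficients come from
mixture_powR_le. *)
Lemma dominated_window_lr_powR k :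
  dominated (fun x => window_lr k x `^ (1 + s))
    (\prod_n (1 + p n `^ (1 + s) * gauss_moment)).
Proof.
have /andP[s0 s1] := s01.
pose v (j : 'I_3) : R := nth 0 [:: 0; 1; 1 + s] j.
pose a n (j : 'I_3) : R := nth 0 [:: (1 - p n) * (1 - s * p n);
  p n + (1 - p n) * (s * p n); p n `^ (1 + s) * gauss_moment] j.
have a0 n j : 0 <= a n j.
  rewrite /a; case: j => -[|[|[|//]]] _ /=.
  - by rewrite mulr_ge0// subr_ge0 mulr_ile1//; [exact: ltW|case/andP: (p01 n)].
  - by rewrite addr_ge0// !mulr_ge0// ltW.
  - by rewrite mulr_ge0 ?powR_ge0 ?expR_ge0.
apply: dominated_le (dominated_prod_tilt k v a0).
  move=> x; rewrite window_lrE powR_prod; last first.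
    by move=> n; rewrite addr_ge0// mulr_ge0// expR_ge0.
  apply: ler_prod => n _; rewrite powR_ge0/=.
  apply: le_trans (mixture_powR_le (p01 n) (expR_ge0 _) s01) _.
  rewrite !big_ord_recl big_ord0 /a /v/= tilt0 mulr1 addr0.
  by rewrite tilt_powR mulrA addrA.
apply: ler_prod => n _; rewrite sumr_ge0//=.
rewrite !big_ord_recl big_ord0 /a/= addr0 addrA lerD2r.
by rewrite le_eqVlt; apply/orP; left; apply/eqP; ring.
Qed.

(** In L L ^ s, expand the first factor over the windows. Against window k,
split L into the contribution of k, to which subadditivity applies, and the
rest, whose power s is replaced by its tangent; the resulting products
involve two distinct windows and have integral 1. *)
Lemma dominated_mixture_powR C :
  (0 < K)%N -> (forall k, dominated (fun x => window_lr k x `^ (1 + s)) C) ->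
  dominated (fun x => (K%:R^-1 * \sum_k window_lr k x) `^ (1 + s))
    (1 + K%:R `^ (- s) * C).
Proof.
move=> K0 HC; have /andP[s0 s1] := s01.
have KR0 : 0 < K%:R :> R by rewrite ltr0n.
have Ki0 : 0 <= K%:R^-1 :> R by rewrite invr_ge0 ltW.
apply: (dominated_le (g := fun x => K%:R^-1 * \sum_k
  (K%:R `^ (- s) * window_lr k x `^ (1 + s) + (1 - s) * window_lr k x +
   s * K%:R^-1 * \sum_(l | l != k) window_lr k x * window_lr l x))
  (c := K%:R^-1 * \sum_(k < K)
  (K%:R `^ (- s) * C + (1 - s) * 1 + s * K%:R^-1 * \sum_(l < K | l != k) 1))).
- move=> x; set L := K%:R^-1 * _.
  have L0 : 0 <= L.
    by apply: mulr_ge0 => //; apply: sumr_ge0 => k _; exact: window_lr_ge0.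
  rewrite powRD ?powRr1//; last by rewrite gt_eqF//; lra.
  rewrite {1}/L -mulrA mulr_suml ler_wpM2l//; apply: ler_sum => k _.
  set rest := K%:R^-1 * \sum_(l | l != k) window_lr l x.
  have rest0 : 0 <= rest.
    by apply: mulr_ge0 => //; apply: sumr_ge0 => l _; exact: window_lr_ge0.
  have LE : L = K%:R^-1 * window_lr k x + rest.
    by rewrite /L /rest (bigD1 k)//= mulrDr.
  have w0 := window_lr_ge0 k x.
  rewrite -mulr_sumr.
  apply: (@le_trans _ _ (window_lr k x *
    (K%:R `^ (- s) * window_lr k x `^ s + (1 - s + s * rest)))).
    apply: ler_wpM2l => //; rewrite LE.
    apply: le_trans (powR_subadditive _ rest0 s01) _; first exact: mulr_ge0.
    rewrite powRM// lerD ?powR_le_tangent//.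
    by rewrite -(powR_inv1 (ltW KR0)) -powRrM mulN1r.
  rewrite (_ : window_lr k x `^ (1 + s) = window_lr k x * window_lr k x `^ s).
    by rewrite /rest le_eqVlt; apply/orP; left; apply/eqP; ring.
  by rewrite powRD ?powRr1// gt_eqF//; lra.
- rewrite mulr1; under eq_bigr => k _.
    rewrite sumr_const (_ : #|_| = K.-1); last first.
      by rewrite cardC1 card_ord.
    over.
  rewrite sumr_const card_ord -[X in _ * X <= _]mulr_natl mulKf ?gt_eqF//.
  have : s / K%:R * K.-1%:R <= s.
    rewrite -mulrA; apply: ler_piMr; first exact: ltW.
    by rewrite ler_pdivrMl// mulr1 ler_nat leq_pred.
  lra.
apply: dominatedZ => //; apply: dominated_sum => k _.
apply: dominatedD; first apply: dominatedD.
- by apply: dominatedZ; [exact: powR_ge0|exact: HC].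
- by apply: dominatedZ; [rewrite subr_ge0|exact: dominated_window_lr].
apply: dominatedZ; first by rewrite mulr_ge0// ltW.
by apply: dominated_sum => l lk; apply: dominated_window_lrM; rewrite eq_sym.
Qed.

End windows.

(** * Average errors of a test *)

Section bayes_bound.
Context {R : realType} {T N K : nat}.
Variables (theta : 'I_K -> 'I_T -> R) (Q : R).
Hypothesis theta_norm : forall k, \sum_t theta k t ^+ 2 = Q.
Hypothesis theta_disj : forall k l t, k != l -> theta k t * theta l t = 0.
Variables (p : 'I_N -> R) (s : R).
Hypothesis p01 : forall n, 0 <= p n <= 1.
Hypothesis s01 : 0 < s <= 1.

Lemma type2_errorE (psi : test R T N) (mu : 'M[R]_(T, N)) :
  type2_error psi mu = 1 - type1_error psi mu.
Proof.
have mpsi b : measurable (psi @^-1` [set b]).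
  by rewrite -[X in measurable X]setTI; exact: measurable_funP.
rewrite /type2_error /type1_error.
have -> : psi @^-1` [set false] = ~` (psi @^-1` [set true]).
  by apply/seteqP; split=> x /=; case: (psi x).
by rewrite probability_setC// fineB// fin_num_measure.
Qed.

Lemma type1_error_ge0 (psi : test R T N) (mu : 'M[R]_(T, N)) :
  0 <= type1_error psi mu.
Proof. exact: fine_ge0. Qed.

Lemma type2_error_ge0 (psi : test R T N) (mu : 'M[R]_(T, N)) :
  0 <= type2_error psi mu.
Proof. exact: fine_ge0. Qed.

(** Markov's inequality for 2 ^ - m, where m is the number of affected
sequences: its mean is a product over the sequences, as their choices are
independent. *)
Lemma weight_few_le (V : nat) :
  \sum_(S : {ffun 'I_N -> bool} | ~~ (V < #|[pred n | S n]|)%N) weight p S <=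
  2 ^+ V * \prod_n (1 - p n / 2).
Proof.
pose half (b : bool) : R := if b then 1 / 2 else 1.
have -> : \prod_n (1 - p n / 2) =
    \sum_(S : {ffun 'I_N -> bool}) \prod_n (coin p n (S n) * half (S n)).
  rewrite -(bigA_distr_bigA (fun n b => coin p n b * half b)).
  by apply: eq_bigr => n _; rewrite big_bool /coin /half /=; field.
rewrite mulr_sumr [leRHS](bigID (fun S : {ffun 'I_N -> bool} =>
  ~~ (V < #|[pred n | S n]|)%N))/= -[leLHS]addr0; apply: lerD; last first.
  apply: sumr_ge0 => S _; rewrite mulr_ge0// prodr_ge0// => n _.
  rewrite mulr_ge0//; first exact: coin_ge0.
  by case: (S n) => /=; rewrite ?divr_ge0.
apply: ler_sum => S; rewrite -leqNgt => SV.
rewrite big_split/= mulrCA ler_peMr ?weight_ge0//.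
rewrite (bigID [pred n | S n])/= [X in _ * (_ * X)]big1 ?mulr1; last first.
  by move=> n; rewrite /half => /negbTE ->.
rewrite (eq_bigr (fun=> 2^-1)); last first.
  by move=> n; rewrite /half => ->; rewrite mul1r.
rewrite prodr_const exprVn ler_pdivlMr ?exprn_gt0//.
by rewrite mul1r; apply: ler_weXn2l => //; rewrite ler1n.
Qed.

(** The average type II error over the prior is at least 1 minus the power
bounded by mixture_le_level. Draws with at most V affected sequences may fall
outside the alternative; they carry mass at most 1 / 2 and their type II
error is bounded by 1. *)
Lemma bayes_bound (psi : test R T N) (V : nat) (alpha beta lam : R) :
  (0 < K)%N -> type1_error psi 0 <= alpha -> 0 <= beta ->
  (forall k (S : {ffun 'I_N -> bool}), (V < #|[pred n | S n]|)%N ->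
     type2_error psi (affected theta k S) <= beta) ->
  2 ^+ V * \prod_n (1 - p n / 2) <= 1 / 2 ->
  \prod_n (1 + p n `^ (1 + s) * gauss_moment Q s) <= K%:R `^ s ->
  0 < lam ->
  1 / 2 <= beta + lam * alpha + 2 * lam `^ (- s).
Proof.
move=> K0 a_le b0 b_le few momK lam0; have /andP[s0 _] := s01.
have KR0 : 0 < K%:R :> R by rewrite ltr0n.
pose I := ('I_K * {ffun 'I_N -> bool})%type.
pose w (i : I) := K%:R^-1 * weight p i.2.
pose mu (i : I) := affected theta i.1 i.2.
have w0 i : 0 <= w i.
  by rewrite mulr_ge0 ?weight_ge0// invr_ge0 ltW.
have pairE (F : 'I_K -> {ffun 'I_N -> bool} -> R) :
    \sum_(i : I) F i.1 i.2 = \sum_k \sum_S F k S.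
  by rewrite pair_bigA.
have w1 : \sum_i w i = 1.
  rewrite (pairE (fun k S => K%:R^-1 * weight p S)).
  under eq_bigr do rewrite -mulr_sumr sum_weight mulr1.
  by rewrite sumr_const card_ord -[LHS]mulr_natl divff// gt_eqF.
have mpsi : measurable (psi @^-1` [set true]).
  by rewrite -[X in measurable X]setTI; exact: measurable_funP.
have domL : dominated (fun x => (\sum_i w i * lr (mu i) x) `^ (1 + s)) 2.
  have := dominated_mixture_powR theta_disj p01 s01 K0
    (dominated_window_lr_powR theta_norm p01 s01).
  apply: dominated_le => [x|].
    rewrite (pairE (fun k S =>
      K%:R^-1 * weight p S * lr (affected theta k S) x)).
    rewrite mulr_sumr; under [X in X `^ _ <= _]eq_bigr => k _.
      under eq_bigr do rewrite -mulrA.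
      rewrite -mulr_sumr; over.
    exact: lexx.
  rewrite -[leRHS]/(1 + 1) lerD2l powRN mulrC ler_pdivrMr ?powR_gt0//.
  by rewrite mul1r.
have /= lvl := mixture_le_level mpsi w0 s0 lam0 domL.
have lower : 1 - (beta + 1 / 2) <=
    \sum_i w i * fine (data_law (mu i) (psi @^-1` [set true])).
  have -> : \sum_i w i * fine (data_law (mu i) (psi @^-1` [set true])) =
      1 - \sum_i w i * type2_error psi (mu i).
    rewrite -w1 -sumrB; apply: eq_bigr => i _; rewrite type2_errorE.
    by rewrite /type1_error; ring.
  rewrite lerD2l lerN2 (bigID (fun i : I => (V < #|[pred n | i.2 n]|)%N))/=.
  apply: lerD.
    apply: (@le_trans _ _ (\sum_(i : I) w i * beta)); last first.
      by rewrite -mulr_suml w1 mul1r.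
    rewrite [leRHS](bigID (fun i : I => (V < #|[pred n | i.2 n]|)%N))/=.
    rewrite -[leLHS]addr0 lerD//; last first.
      by apply: sumr_ge0 => i _; rewrite mulr_ge0.
    by apply: ler_sum => i iV; rewrite ler_wpM2l// b_le.
  apply: le_trans few; apply: le_trans (weight_few_le V).
  apply: (@le_trans _ _
      (\sum_(i : I | ~~ (V < #|[pred n | i.2 n]|)%N) w i)).
    apply: ler_sum => i _; rewrite ler_piMr// type2_errorE.
    by rewrite lerBlDr lerDl type1_error_ge0.
  have -> : \sum_(i : I | ~~ (V < #|[pred n | i.2 n]|)%N) w i =
      \sum_(k < K) \sum_(S : {ffun 'I_N -> bool} |
        ~~ (V < #|[pred n | S n]|)%N) K%:R^-1 * weight p S.
    by rewrite pair_big.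
  under eq_bigr do rewrite -mulr_sumr.
  rewrite sumr_const card_ord -[leLHS]mulr_natl mulrA divff ?mul1r//.
  by rewrite gt_eqF.
have : lam * fine (data_law 0 (psi @^-1` [set true])) <= lam * alpha.
  by rewrite ler_pM2l.
lra.
Qed.

End bayes_bound.

(** * Mean arrays with one window *)

Section single_window.
Context {R : realType}.

(** No change-point lies strictly within distance H of c, so neither do the
neighbours of c in the sorted list; beyond its last entry, tau returns T. *)
Lemma mem_Omega1 (T N V H c : nat) (mu : 'M[R]_(T, N)) (Delta h : R) :
  h <= H%:R -> (H <= c)%N -> (c + H <= T)%N -> c \in change_points mu ->
  {in change_points mu, forall t, [|| t + H <= c, t == c | c + H <= t]%N} ->
  (V <= #|[pred n | (Delta <= `|mean mu c.+1 n - mean mu c n|)%R ]|)%N ->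
  Omega1 T N Delta V h mu.
Proof.
move=> hH Hc cT cmu gap jumps; pose i := index c (change_points mu).
have sorted_mu : sorted ltn (change_points mu).
  by apply: (sorted_filter ltn_trans); exact: iota_ltn_sorted.
have isz : (i < size (change_points mu))%N by rewrite index_mem.
have tau_i : tau mu i.+1 = c by rewrite /tau/= nth_index.
exists i.+1; split; last by rewrite /jump_count tau_i.
  by rewrite ltnS leq0n.
pose cp := change_points mu.
have left_gap t : (t < c)%N ->
    [|| t + H <= c, t == c | c + H <= t]%N -> (H <= c - t)%N.
  clear; lia.
have right_gap t : (c < t)%N ->
    [|| t + H <= c, t == c | c + H <= t]%N -> (H <= t - c)%N.
  clear; lia.
have before : (H <= c - tau mu i)%N.
  rewrite /tau; case Ei: i => [|i'] /=; first by rewrite subn0.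
  have i'i : (i' < i)%N by rewrite Ei.
  have i'sz : (i' < size cp)%N by apply: ltn_trans isz.
  have lt_c : (nth T cp i' < c)%N.
    rewrite -[X in (_ < X)%N](nth_index T cmu).
    by apply: (sorted_ltn_nth ltn_trans T sorted_mu).
  exact: left_gap lt_c (gap _ (mem_nth T i'sz)).
have after : (H <= tau mu i.+2 - c)%N.
  rewrite /tau/=; have [i1sz|szi1] := ltnP i.+1 (size cp); last first.
    by rewrite nth_default//; lia.
  have gt_c : (c < nth T cp i.+1)%N.
    rewrite -[X in (X < _)%N](nth_index T cmu).
    by apply: (sorted_ltn_nth ltn_trans T sorted_mu); rewrite ?inE.
  exact: right_gap gt_c (gap _ (mem_nth T i1sz)).
by apply: (le_trans hH); rewrite ler_nat leq_min tau_i before after.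
Qed.

Definition profile (H k : nat) (t : nat) : R :=
  if (2 * H * k <= t < 2 * H * k + H)%N then - 1
  else if (2 * H * k + H <= t < 2 * H * k.+1)%N then 1 else 0.

Lemma profile_disj H k l t : k != l -> profile H k t * profile H l t = 0.
Proof.
rewrite /profile neq_ltn => kl.
have sep i j : (i < j -> 2 * H * i.+1 <= 2 * H * j)%N.
  by move=> ij; rewrite leq_mul2l ij orbT.
have [/sep|/sep] := orP kl; do ![case: ifP]; rewrite ?mulr0 ?mul0r//; lia.
Qed.

Lemma sum_profile_sqr T K H k : (2 * H * K <= T)%N -> (k < K)%N ->
  \sum_(t < T) profile H k t ^+ 2 = (2 * H)%:R.
Proof.
move=> HKT kK.
have HkT : (2 * H * k.+1 <= T)%N.
  by rewrite (leq_trans _ HKT)// leq_mul2l kK orbT.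
rewrite (eq_bigr (fun t : 'I_T => if (2 * H * k <= t < 2 * H * k.+1)%N
  then 1 else 0 : R)); last first.
  move=> t _; rewrite /profile.
  do ![case: ifP]; rewrite ?sqrrN ?expr1n ?expr0n//; lia.
rewrite -(big_mkord predT (fun t =>
  if (2 * H * k <= t < 2 * H * k.+1)%N then 1 else 0 : R)).
have kk1 : (2 * H * k <= 2 * H * k.+1)%N by rewrite leq_mul2l leqnSn orbT.
rewrite (@big_cat_nat _ _ _ (2 * H * k))//=; last exact: leq_trans kk1 HkT.
rewrite [X in _ + X](@big_cat_nat _ _ _ (2 * H * k.+1))//=.
rewrite big_nat big1 ?add0r; last by move=> t tk; case: ifP => //; lia.
rewrite [X in _ + X]big_nat [X in _ + X]big1 ?addr0; last first.
  by move=> t tk; case: ifP => //; lia.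
rewrite big_nat (eq_bigr (fun=> 1)); last by move=> t ->.
by rewrite -big_nat sumr_const_nat; congr (_%:R); lia.
Qed.

End single_window.

(** * The bound for a given sample size *)

Section minimax.
Context {R : realType} {T N : nat}.

Definition step (K H : nat) (Delta : R) (k : 'I_K) (t : 'I_T) : R :=
  Delta / 2 * profile H k t.

Lemma mean_affected K H Delta k (S : {ffun 'I_N -> bool}) t n :
  (2 * H * K <= T)%N ->
  mean (affected (@step K H Delta) k S) t n =
  Delta / 2 * profile H k t.-1 * (S n)%:R.
Proof.
move=> HKT; rewrite /mean; case: insubP => [i _ <-|]; first by rewrite /= mxE.
rewrite -leqNgt /= => Tt; rewrite /profile.
have HkT : (2 * H * k.+1 <= T)%N.
  by rewrite (leq_trans _ HKT)// leq_mul2l ltn_ord orbT.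
do ![case: ifP]; rewrite ?mulr0 ?mul0r//; lia.
Qed.

Lemma affected_Omega1 K H V Delta (h : R) k (S : {ffun 'I_N -> bool}) :
  (2 * H * K <= T)%N -> (0 < H)%N -> 0 < Delta -> h <= H%:R ->
  (V < #|[pred n | S n]|)%N ->
  Omega1 T N Delta V.+1 h (affected (@step K H Delta) k S).
Proof.
move=> HKT H0 D0 hH SV; set mu := affected _ k S.
have meanE t n : mean mu t n = Delta / 2 * profile H k t.-1 * (S n)%:R.
  exact: mean_affected.
have HkT : (2 * H * k.+1 <= T)%N.
  by rewrite (leq_trans _ HKT)// leq_mul2l ltn_ord orbT.
pose c := (2 * H * k + H)%N.
have cT : (c + H <= T)%N by apply: leq_trans HkT; rewrite /c; lia.
have jump n : S n -> mean mu c.+1 n - mean mu c n = Delta.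
  move=> Sn; rewrite !meanE Sn /profile !mulr1/= /c.
  rewrite ifF; last by lia.
  rewrite ifT; last by lia.
  rewrite ifT; last by lia.
  by field.
apply: (@mem_Omega1 _ _ _ _ H c) => //; first by rewrite /c; lia.
- rewrite mem_filter mem_iota; apply/andP; split; last by rewrite /c; lia.
  have [n Sn] : exists n, S n.
    have /card_gt0P[n Sn] : (0 < #|[pred n | S n]|)%N.
      exact: leq_ltn_trans SV.
    by exists n.
  apply/existsP; exists n; rewrite eq_sym -subr_eq0 jump//.
  by rewrite gt_eqF.
- move=> t; rewrite mem_filter mem_iota => /andP[/existsP[n mut] tT].
  have /eqP : profile H k t.-1 != profile H k t :> R.
    by apply: contra_neq mut => E; rewrite !meanE E.
  rewrite /profile /c; do ![case: ifP] => //; lia.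
- apply: leq_trans SV _; apply: subset_leq_card; apply/fintype.subsetP => n.
  rewrite !inE => Sn; rewrite jump// gtr0_norm//.
Qed.

(** Both suprema are bounded below by the errors at the null array 0 and at the
arrays of the prior, all of which bayes_bound averages. The exponent
s (1 + s) / 4 (H Delta ^ 2) is s (1 + s) Q / 2. *)
Lemma minimax_bound (psi : test R T N) (K H V : nat) (Delta h s lam : R)
    (p : 'I_N -> R) :
  (0 < K)%N -> (0 < H)%N -> (2 * H * K <= T)%N -> 0 < Delta -> h <= H%:R ->
  0 < s <= 1 -> (forall n, 0 <= p n <= 1) ->
  2 ^+ V * \prod_n (1 - p n / 2) <= 1 / 2 ->
  \prod_n (1 + p n `^ (1 + s) *
    expR (s * (1 + s) / 4 * (H%:R * Delta ^+ 2))) <= K%:R `^ s ->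
  1 <= lam ->
  1 / 2 <= lam * total_error psi Delta V.+1 h + 2 * lam `^ (- s).
Proof.
move=> K0 H0 HKT D0 hH s01 p01 few mom lam1.
have lam0 : 0 < lam by exact: lt_le_trans lam1.
pose Q := H%:R * Delta ^+ 2 / 2.
have theta_norm (k : 'I_K) : \sum_t step H Delta k t ^+ 2 = Q.
  rewrite /step; under eq_bigr do rewrite exprMn.
  by rewrite -mulr_sumr (sum_profile_sqr HKT (ltn_ord k)) natrM /Q; field.
have theta_disj (k l : 'I_K) t : k != l ->
    step H Delta k t * step H Delta l t = 0.
  by move=> kl; rewrite /step mulrACA profile_disj ?mulr0.
rewrite /total_error; set alpha := sup _; set beta := sup _.
have err_le1 mu : type2_error psi mu <= 1.
  by rewrite type2_errorE lerBlDr lerDl type1_error_ge0.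
have err1_le1 mu : type1_error psi mu <= 1.
  by have := type2_error_ge0 psi mu; rewrite type2_errorE subr_ge0.
have le_beta mu : Omega1 T N Delta V.+1 h mu -> type2_error psi mu <= beta.
  move=> mu1; apply: ub_le_sup; last by exists mu.
  by exists 1 => _ [nu _ <-].
have beta0 : 0 <= beta.
  have [[mu mu1]|no] := pselect (exists mu, Omega1 T N Delta V.+1 h mu).
    exact: le_trans (type2_error_ge0 psi mu) (le_beta _ mu1).
  rewrite /beta (_ : [set _ | _ in _] = set0) ?sup0//.
  by apply/seteqP; split=> // y [mu mu1 _]; case: no; exists mu.
have le_alpha : type1_error psi 0 <= alpha.
  apply: ub_le_sup; first by exists 1 => _ [nu _ <-].
  exists 0 => //; rewrite /Omega0 /= /num_change_points /change_points.
  apply/eqP; rewrite size_eq0; apply/negPn; rewrite -has_filter.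
  apply/hasPn => t _; apply/existsP => -[n]; rewrite /mean.
  by do 2 case: insubP => [? _ _|_] /=; rewrite ?mxE eqxx.
have alpha0 : 0 <= alpha by exact: le_trans (type1_error_ge0 psi 0) le_alpha.
have mom' : \prod_n (1 + p n `^ (1 + s) * gauss_moment Q s) <= K%:R `^ s.
  rewrite /gauss_moment (_ : _ * Q = s * (1 + s) / 4 * (H%:R * Delta ^+ 2))//.
  by rewrite /Q; field.
have := bayes_bound theta_norm theta_disj p01 s01 K0 le_alpha beta0 _ few mom'
  lam0.
move=> /(_ _)/le_trans; apply.
  by move=> k S SV; apply: le_beta; exact: affected_Omega1.
rewrite lerD2r mulrDr addrC lerD2l.
by rewrite ler_peMl.
Qed.

End minimax.

Section finite_sample.
Context {R : realType}.

Section bounds.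
Context {T N : nat}.
Variables (psi : test R T N) (K H V : nat) (Delta h s lam : R).
Hypotheses (K0 : (0 < K)%N) (H0 : (0 < H)%N) (HKT : (2 * H * K <= T)%N).
Hypotheses (D0 : 0 < Delta) (hH : h <= H%:R) (s01 : 0 < s <= 1).
Hypotheses (V0 : (0 < V)%N) (lam1 : 1 <= lam).

Let E : R := expR (s * (1 + s) / 4 * (H%:R * Delta ^+ 2)).

(** The degenerate prior which affects the first V sequences. The number of
affected sequences is exactly V, and 2 ^ (V - 1) 2 ^ - V = 1 / 2. *)
Lemma fixed_rows_bound : (V <= N)%N -> (1 + E) ^+ V <= K%:R `^ s ->
  1 / 2 <= lam * total_error psi Delta V h + 2 * lam `^ (- s).
Proof.
move=> VN mom; pose p (n : 'I_N) : R := (n < V)%:R.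
have prod_p (f : bool -> R) : f false = 1 ->
    \prod_(n < N) f (n < V)%N = f true ^+ V.
  move=> f0; rewrite (bigID (fun n : 'I_N => (n < V)%N))/=.
  rewrite [X in _ * X]big1 ?mulr1; last by move=> n /negbTE ->.
  rewrite (eq_bigr (fun=> f true)); last by move=> n ->.
  by rewrite -(big_ord_widen N (fun=> f true) VN) prodr_const card_ord.
rewrite -(prednK V0).
apply: (@minimax_bound _ _ _ _ _ _ _ _ _ _ _ p K0 H0 HKT D0 hH s01) _ _ _
  lam1.
- by move=> n; rewrite /p; case: (_ < _)%N; rewrite ?lexx ?ler01.
- rewrite (prod_p (fun b => 1 - b%:R / 2)); last by rewrite mul0r subr0.
  rewrite -[X in _ * _ ^+ X](prednK V0) exprS mulrCA -exprMn /=.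
  have -> : 2 * (1 - 1 / 2) = 1 :> R by field.
  rewrite expr1n; lra.
- rewrite (prod_p (fun b => 1 + b%:R `^ (1 + s) * E)); last first.
    by rewrite powR0 ?mul0r ?addr0// gt_eqF//; move: s01; lra.
  by rewrite powR1 mul1r.
Qed.

(** The mean number of affected sequences is 4 V, which makes
2 ^ (V - 1) (1 - q / 2) ^ N at most 2 ^ (V - 1) exp (- 2 V). *)
Lemma random_rows_bound (q : R) : q <= 1 -> q * N%:R = 4 * V%:R ->
  expR (N%:R * (q `^ (1 + s) * E)) <= K%:R `^ s ->
  1 / 2 <= lam * total_error psi Delta V h + 2 * lam `^ (- s).
Proof.
move=> q1 qN mom.
have V0R : 0 < V%:R :> R by rewrite ltr0n.
have q0 : 0 <= q.
  rewrite leNgt; apply/negP => qlt0; have := ler0n R N; nra.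
rewrite -(prednK V0).
apply: (@minimax_bound _ _ _ _ _ _ _ _ _ _ _ (fun=> q) K0 H0 HKT D0 hH s01)
  _ _ _ lam1.
- by move=> n; rewrite q0.
- rewrite prodr_const card_ord.
  have le_exp : (1 - q / 2) ^+ N <= expR (- 2 * V%:R).
    rewrite (_ : - 2 * _ = N%:R * - (q / 2)); last lra.
    rewrite expRM_natl; apply: lerXn2r; rewrite ?nnegrE ?expR_ge0//.
      lra.
    exact: expR_ge1Dx.
  apply: (@le_trans _ _ (2 ^+ V.-1 * expR (- 2 * V%:R))).
    by rewrite ler_wpM2l// exprn_ge0.
  rewrite mulNr expRN ler_pdivrMr ?expR_gt0//.
  have : 2 ^+ V.-1 * 2 <= expR (2 * V%:R) :> R.
    rewrite -exprSr (prednK V0) expRM_natr.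
    apply: lerXn2r; rewrite ?nnegrE ?expR_ge0//.
    by apply: le_trans (expR_ge1Dx 2); lra.
  lra.
- rewrite prodr_const card_ord; apply: le_trans mom.
  rewrite expRM_natl; apply: lerXn2r; rewrite ?nnegrE ?expR_ge0//.
    by rewrite addr_ge0// mulr_ge0 ?powR_ge0 ?expR_ge0.
  exact: expR_ge1Dx.
Qed.

End bounds.

(** There are about T / 2H windows, and H is of order at most
T ^ (2 eta) log T; the logarithm and the constants are absorbed by
T ^ delta. *)
Lemma window_count (T : nat) (h B delta eta : R) : (0 < T)%N -> 0 <= h ->
  0 <= eta -> 0 <= 1 - 2 * eta - delta -> 0 <= B ->
  h <= B * ln T%:R * expR (2 * eta * ln T%:R) ->
  4 * (B * ln T%:R + 1) <= expR (delta * ln T%:R) ->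
  exists K H : nat, [/\ (0 < K)%N, (0 < H)%N, (2 * H * K <= T)%N,
    h <= H%:R <= h + 1 & expR ((1 - 2 * eta - delta) * ln T%:R) <= K%:R].
Proof.
move=> T0 h0 eta0 delta1 B0 hB Bd; set tau := ln _ in hB Bd *.
have T1 : 1 <= T%:R :> R by rewrite ler1n.
have tau0 : 0 <= tau by exact: ln_ge0.
have TE : T%:R = expR tau by rewrite lnK// posrE ltr0n.
pose H := (Num.truncn h).+1.
have hH : h < H%:R by exact: truncnS_gt.
have Hh : H%:R <= h + 1 by rewrite -natr1 lerD2r truncn_le.
pose K := (T %/ (2 * H))%N.
have H0 : 0 < H%:R :> R by rewrite ltr0n.
have Klt : T%:R < 2 * H%:R * (K%:R + 1) :> R.
  by rewrite natr1 -!natrM ltr_nat mulnC ltn_ceil.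
set u := expR ((1 - 2 * eta - delta) * tau).
have u1 : 1 <= u by rewrite -expR0 ler_expR mulr_ge0.
have v1 : 1 <= expR (2 * eta * tau) by rewrite -expR0 ler_expR !mulr_ge0.
have TuE : T%:R = u * expR (delta * tau) * expR (2 * eta * tau).
  by rewrite TE -!expRD; congr expR; ring.
have uK : u <= K%:R.
  rewrite -(lerD2r 1); apply: (@le_trans _ _ (2 * u)); first lra.
  apply/ltW; rewrite -(ltr_pM2l (_ : 0 < 2 * H%:R)) ?mulr_gt0//.
  apply: le_lt_trans Klt; rewrite TuE.
  have : H%:R <= (B * tau + 1) * expR (2 * eta * tau).
    apply: le_trans Hh _; rewrite mulrDl mul1r; lra.
  move=> /(ler_wpM2l (_ : 0 <= 4 * u)) HH.
  apply: (@le_trans _ _ (4 * u * ((B * tau + 1) * expR (2 * eta * tau)))).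
    by apply: le_trans (HH _); lra.
  have := ler_wpM2l (_ : 0 <= u * expR (2 * eta * tau)) Bd.
  rewrite mulr_ge0 ?expR_ge0// => /(_ isT); lra.
exists K, H; split => //.
- by rewrite -(ltr0n R); lra.
- by rewrite mulnC leq_divM.
- by rewrite ltW.
Qed.

End finite_sample.

(** * The two sparsity regimes *)

Section regimes.
Context {R : realType} {T N : nat}.
Variables (psi : test R T N) (V : nat) (D0 eta eps lam : R).
Hypotheses (T0 : (0 < T)%N) (V0 : (0 < V)%N) (D00 : 0 < D0).
Hypotheses (eta01 : 0 <= eta < 1 / 2) (eps01 : 0 < eps < 1) (lam1 : 1 <= lam).

Let tau : R := ln T%:R.
Let Delta : R := D0 * expR (- (eta * tau)).

Let tau0 : 0 <= tau. Proof. by apply: ln_ge0; rewrite ler1n. Qed.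

Let Delta0 : 0 < Delta. Proof. by rewrite mulr_gt0// expR_gt0. Qed.

Let Delta_sqr : Delta ^+ 2 = D0 ^+ 2 / expR (2 * eta * tau).
Proof.
rewrite exprMn -expRM_natl -expRN; congr (_ * expR _); ring.
Qed.

Let Delta_le : Delta ^+ 2 <= D0 ^+ 2.
Proof.
rewrite Delta_sqr ler_pdivrMr ?expR_gt0// ler_peMr ?sqr_ge0//.
by rewrite -expR0 ler_expR !mulr_ge0//; case/andP: eta01.
Qed.

(** The V signals have total exponent
s (1 + s) (1 - 2 eta) (1 - eps) log T, and (1 + s) (1 - eps) <= 1 - s for
s = eps / 2. This leaves s ^ 2 (1 - 2 eta) log T of room below
s (1 - 2 eta) log T: one half pays for the loss in the number of windows, and
the other for the rounding of h and for the constants raised to the power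
V. *)
Lemma sparse_undetectable (h : R) : (V <= N)%N ->
  h = 4 * (1 - 2 * eta) * (1 - eps) * (tau / (Delta ^+ 2 * V%:R)) ->
  4 * (4 / D0 ^+ 2 * tau + 1) <= expR (eps / 2 * (1 - 2 * eta) / 2 * tau) ->
  V%:R * (1 + D0 ^+ 2) <= (eps / 2) ^+ 2 * (1 - 2 * eta) / 2 * tau ->
  1 / 2 <= lam * total_error psi Delta V h + 2 * lam `^ (- (eps / 2)).
Proof.
move=> VN hE growth VT; set s := eps / 2 in growth VT *.
have [eps0 eps1] := andP eps01; have [eta0 eta1] := andP eta01.
have s01 : 0 < s <= 1 by rewrite /s; apply/andP; split; lra.
have V1 : 1 <= V%:R :> R by rewrite ler1n.
have D2 : 0 < Delta ^+ 2 by rewrite exprn_gt0.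
have D02 : 0 < D0 ^+ 2 by rewrite exprn_gt0.
have g0 : 0 < 1 - 2 * eta by lra.
have hV : h * Delta ^+ 2 * V%:R = 4 * (1 - 2 * eta) * (1 - eps) * tau.
  by rewrite hE; field; rewrite !gt_eqF//; lra.
have c1 : (1 - 2 * eta) * (1 - eps) <= 1 by rewrite mulr_ile1; lra.
have c0 : 0 <= (1 - 2 * eta) * (1 - eps) by rewrite mulr_ge0; lra.
have h0 : 0 <= h.
  rewrite hE; apply: mulr_ge0; first by lra.
  by rewrite divr_ge0// mulr_ge0// ltW.
have hB : h <= 4 / D0 ^+ 2 * tau * expR (2 * eta * tau).
  have -> : 4 / D0 ^+ 2 * tau * expR (2 * eta * tau) = 4 * tau / Delta ^+ 2.
    by rewrite Delta_sqr; field; rewrite !gt_eqF ?expR_gt0.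
  rewrite ler_pdivlMr//.
  have hD0 : 0 <= h * Delta ^+ 2 by rewrite mulr_ge0// ltW.
  have := ler_peMr hD0 V1; rewrite hV => /le_trans; apply.
  have := ler_wpM2r tau0 c1; lra.
have d1 : 0 <= 1 - 2 * eta - s * (1 - 2 * eta) / 2 by rewrite /s; nra.
have B0 : 0 <= 4 / D0 ^+ 2 by rewrite divr_ge0// ltW.
have [K [H [K0 H0 HKT /andP[hH Hh1] uK]]] :=
  window_count T0 h0 eta0 d1 B0 hB growth.
apply: (fixed_rows_bound psi K0 H0 HKT Delta0 hH s01 V0 lam1 VN).
have ss0 : 0 <= s * (1 + s) / 4 by rewrite divr_ge0// mulr_ge0//; lra.
set E := expR _.
have E1 : 1 <= E.
  by rewrite -expR0 ler_expR mulr_ge0// mulr_ge0// ltW.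
have EV : (1 + E) ^+ V <=
    expR (V%:R * (1 + s * (1 + s) / 4 * (H%:R * Delta ^+ 2))).
  rewrite expRM_natl; apply: lerXn2r; rewrite ?nnegrE ?expR_ge0//; first lra.
  rewrite expRD -/E; have := expR_ge1Dx (1 : R); nra.
apply: (le_trans EV).
apply: (@le_trans _ _
  (expR ((1 - 2 * eta - s * (1 - 2 * eta) / 2) * tau) `^ s)); last first.
  by apply: ge0_ler_powR; rewrite ?nnegrE ?expR_ge0//; lra.
rewrite powR_expR ler_expR.
have HD : V%:R * (H%:R * Delta ^+ 2) <=
    4 * (1 - 2 * eta) * (1 - eps) * tau + V%:R * D0 ^+ 2.
  have -> : 4 * (1 - 2 * eta) * (1 - eps) * tau = V%:R * (h * Delta ^+ 2).
    by rewrite -hV; ring.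
  rewrite -mulrDr ler_wpM2l ?ler0n//.
  have := ler_wpM2r (ltW D2) Hh1; have := Delta_le; lra.
have ss1 : s * (1 + s) / 4 <= 1 by nra.
have VD0 : 0 <= V%:R * D0 ^+ 2 by rewrite mulr_ge0 ?ler0n// ltW.
have main := ler_wpM2l ss0 HD.
have rest := ler_wpM2r VD0 ss1.
have key : s * (1 + s) * ((1 - 2 * eta) * (1 - eps) * tau) <=
    s * (1 - s) * ((1 - 2 * eta) * tau).
  have gt0 : 0 <= (1 - 2 * eta) * tau by rewrite mulr_ge0// ltW.
  have : (1 + s) * (1 - eps) <= 1 - s by rewrite /s; nra.
  have ss : 0 <= s by lra.
  move=> /(ler_wpM2r gt0)/(ler_wpM2l ss); lra.
have e1 : s * ((1 - 2 * eta - s * (1 - 2 * eta) / 2) * tau) =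
   s * ((1 - 2 * eta) * tau) - s ^+ 2 * (1 - 2 * eta) / 2 * tau by ring.
have e2 : s * (1 - s) * ((1 - 2 * eta) * tau) =
  s * ((1 - 2 * eta) * tau) - 2 * (s ^+ 2 * (1 - 2 * eta) / 2 * tau) by field.
rewrite e1; rewrite e2 in key; lra.
Qed.

(** With q of order N ^ - beta and exp (s (1 + s) Q / 2) of order
N ^ (s (1 + s) (1 - eps) rho), the exponent N q ^ (1 + s) exp (s (1 + s) Q / 2)
has order N ^ (zeta - kap), where kap is the last exponent in the hypotheses;
log K has order at least N ^ zeta. *)
Lemma moderate_undetectable (h rho s beta zeta : R) :
  (0 < N)%N -> 0 < s <= 1 -> 0 < rho ->
  h = 4 * (1 - eps) * rho * (ln N%:R / Delta ^+ 2) ->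
  ln N%:R <= tau ->
  4 * (4 * rho / D0 ^+ 2 * tau + 1) <= expR ((1 - 2 * eta) / 2 * tau) ->
  V%:R <= 2 * N%:R `^ (1 - beta) -> (4 * V <= N)%N ->
  N%:R `^ zeta <= 2 * tau ->
  128 * expR (D0 ^+ 2) <= s * (1 - 2 * eta) / 2 *
    N%:R `^ ((1 + s) * (beta - (1 - eps) * rho * s) - (1 - zeta)) ->
  1 / 2 <= lam * total_error psi Delta V h + 2 * lam `^ (- s).
Proof.
move=> N0 s01 rho0 hE lnN growth Vle VN Nzeta kappa.
have [eps0 eps1] := andP eps01; have [eta0 eta1] := andP eta01.
have [s0 s1] := andP s01; pose l : R := ln N%:R.
have N0R : 0 < N%:R :> R by rewrite ltr0n.
have l0 : 0 <= l by apply: ln_ge0; rewrite ler1n.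
have NE : N%:R = expR l by rewrite lnK// posrE.
have NX x : N%:R `^ x = expR (x * l) by rewrite NE powR_expR.
have D2 : 0 < Delta ^+ 2 by rewrite exprn_gt0.
have D02 : 0 < D0 ^+ 2 by rewrite exprn_gt0.
have g0 : 0 < 1 - 2 * eta by lra.
have hD : h * Delta ^+ 2 = 4 * (1 - eps) * rho * l.
  by rewrite hE -/l; field; rewrite gt_eqF.
have h0 : 0 <= h.
  rewrite hE; apply: mulr_ge0; last by rewrite divr_ge0// ltW.
  by rewrite mulr_ge0//; [lra|exact: ltW].
have hB : h <= 4 * rho / D0 ^+ 2 * tau * expR (2 * eta * tau).
  have -> : 4 * rho / D0 ^+ 2 * tau * expR (2 * eta * tau) =
      4 * rho * tau / Delta ^+ 2.
    by rewrite Delta_sqr; field; rewrite !gt_eqF ?expR_gt0.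
  rewrite ler_pdivlMr// hD.
  have : rho * l <= rho * tau by rewrite ler_pM2l.
  have : 0 <= rho * l by rewrite mulr_ge0// ltW.
  nra.
have d1 : 0 <= 1 - 2 * eta - (1 - 2 * eta) / 2 by lra.
have B0 : 0 <= 4 * rho / D0 ^+ 2 by rewrite divr_ge0 ?mulr_ge0// ltW.
have [K [H [K0 H0 HKT /andP[hH Hh1] uK]]] :=
  window_count T0 h0 eta0 d1 B0 hB growth.
pose q : R := 4 * V%:R / N%:R.
have q1 : q <= 1.
  by rewrite ler_pdivrMr// mul1r -natrM ler_nat.
have q0 : 0 <= q by rewrite divr_ge0 ?mulr_ge0 ?ler0n.
apply: (random_rows_bound psi K0 H0 HKT Delta0 hH s01 V0 lam1 q1).
  by rewrite divfK// gt_eqF.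
have q8 : q <= 8 * expR (- beta * l).
  rewrite ler_pdivrMr//; have := Vle; rewrite NX.
  have -> : (1 - beta) * l = l + - beta * l by ring.
  rewrite expRD -NE; lra.
have qs : q `^ (1 + s) <= 64 * expR (- (1 + s) * beta * l).
  apply: (@le_trans _ _ ((8 * expR (- beta * l)) `^ (1 + s))).
    by apply: ge0_ler_powR; rewrite ?nnegrE ?mulr_ge0 ?expR_ge0//; lra.
  rewrite powRM ?expR_ge0// powR_expR.
  have -> : (1 + s) * (- beta * l) = - (1 + s) * beta * l by ring.
  apply: ler_wpM2r; first exact: expR_ge0.
  apply: (@le_trans _ _ (8 `^ 2)); first by apply: ler_powR; lra.
  by rewrite powR_mulrn// -natrX.
set E := expR (s * (1 + s) / 4 * _).
have EE : E <= expR (D0 ^+ 2) * expR (s * (1 + s) * ((1 - eps) * rho * l)).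
  rewrite -expRD ler_expR.
  have HD : H%:R * Delta ^+ 2 <= 4 * ((1 - eps) * rho * l) + D0 ^+ 2.
    have := ler_wpM2r (ltW D2) Hh1; have := Delta_le; lra.
  have ss0 : 0 <= s * (1 + s) / 4 by rewrite divr_ge0// mulr_ge0//; lra.
  have ss1 : s * (1 + s) / 4 <= 1 by nra.
  have := ler_wpM2l ss0 HD; have := ler_wpM2r (ltW D02) ss1; lra.
have E0 : 0 <= E by exact: expR_ge0.
apply: (@le_trans _ _
  (expR ((1 - 2 * eta - (1 - 2 * eta) / 2) * tau) `^ s)); last first.
  by apply: ge0_ler_powR; rewrite ?nnegrE ?expR_ge0//; lra.
rewrite powR_expR ler_expR.
set kap := _ - (1 - zeta) in kappa.
have step1 : N%:R * (q `^ (1 + s) * E) <=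
    64 * expR (D0 ^+ 2) * (expR (zeta * l) * expR (- (kap * l))).
  have -> : expR (zeta * l) * expR (- (kap * l)) = expR l *
      (expR (- (1 + s) * beta * l) *
       expR (s * (1 + s) * ((1 - eps) * rho * l))).
    by rewrite -!expRD; congr expR; rewrite /kap; ring.
  rewrite {1}NE; have := ler_pM (powR_ge0 _ _) E0 qs EE.
  move=> /(ler_wpM2l (expR_ge0 l)); lra.
apply: (le_trans step1).
rewrite NX in kappa; rewrite NX in Nzeta.
have kapE : 64 * expR (D0 ^+ 2) * expR (- (kap * l)) <= s * (1 - 2 * eta) / 4.
  rewrite expRN ler_pdivrMr ?expR_gt0//; lra.
have pre0 : 0 <= 64 * expR (D0 ^+ 2) * expR (- (kap * l)).
  by rewrite !mulr_ge0 ?expR_ge0.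
have := ler_pM pre0 (expR_ge0 (zeta * l)) kapE Nzeta.
lra.
Qed.

End regimes.

(** * Limits *)

Section asymptotic.
Context {R : realType}.

Lemma near_le_powR (c M : R) : 0 < c -> \forall N \near \oo, M <= N%:R `^ c.
Proof.
move=> c0; near=> N.
have NM : `|M| `^ c^-1 <= N%:R.
  by apply: ltW; near: N; exact: nbhs_infty_gtr.
apply: (le_trans (ler_norm M)).
have -> : `|M| = (`|M| `^ c^-1) `^ c.
  by rewrite -powRrM mulVf ?gt_eqF// powRr1.
by apply: ge0_ler_powR; rewrite ?nnegrE ?powR_ge0 ?ler0n//; exact: ltW.
Unshelve. all: by end_near. Qed.

Lemma near_asymp_equiv (a b : nat -> R) :
  (\forall N \near \oo, 0 < b N) -> asymp_equiv a b ->
  \forall N \near \oo, b N <= 2 * a N /\ a N <= 2 * b N.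
Proof.
move=> b0 /cvgrPdist_le/(_ (1 / 2)) ab.
have {}ab := ab ltac:(lra).
near=> N; have bN : 0 < b N by near: N.
have : `|1 - a N / b N| <= 1 / 2 by near: N.
rewrite ler_norml => /andP[lo hi].
have -> : a N = a N / b N * b N by rewrite divfK// gt_eqF.
split; nra.
Unshelve. all: by end_near. Qed.

Lemma near_powR_gt0 (c : R) : \forall N \near \oo, (0 : R) < N%:R `^ c.
Proof.
near=> N; rewrite powR_gt0// ltr0n; near: N; exact: nbhs_infty_gt.
Unshelve. all: by end_near. Qed.

(** ln N is 2 / c times the logarithm of N ^ (c / 2), hence at most 2 / c times
N ^ (c / 2). *)
Lemma near_ln_le (c delta : R) : 0 < c -> 0 < delta ->
  \forall N \near \oo, ln N%:R <= delta * N%:R `^ c.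
Proof.
move=> c0 d0; near=> N.
have N0 : (0 < N)%N by near: N; exact: nbhs_infty_gt.
have N0R : 0 < N%:R :> R by rewrite ltr0n.
have big : 2 / (c * delta) <= N%:R `^ (c / 2).
  by near: N; apply: near_le_powR; rewrite divr_gt0.
set y := N%:R `^ (c / 2) in big.
have y0 : 0 < y by exact: powR_gt0.
have yy : N%:R `^ c = y * y.
  rewrite /y -powRD; last by rewrite (gt_eqF N0R) implybT.
  by congr (_ `^ _); field.
have lny : ln N%:R = 2 / c * ln y.
  by rewrite ln_powR; field; rewrite gt_eqF.
have := le_ln1Dx (_ : -1 < y - 1).
rewrite addrCA subrr addr0 => /(_ ltac:(lra)) lnle.
rewrite lny yy.
have : 2 / c <= delta * y.
  rewrite -(ler_pM2l d0) in big; apply: le_trans big.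
  by rewrite le_eqVlt; apply/orP; left; apply/eqP; field; rewrite !gt_eqF.
have c2 : 0 <= 2 / c by rewrite divr_ge0// ltW.
move=> /(ler_wpM2r (ltW y0)) H.
have : 2 / c * ln y <= 2 / c * y by apply: ler_wpM2l => //; lra.
lra.
Unshelve. all: by end_near. Qed.

Lemma linear_le_expR (B delta x : R) : 0 <= B -> 0 < delta -> 1 <= x ->
  16 * (B + 1) / delta ^+ 2 <= x -> 4 * (B * x + 1) <= expR (delta * x).
Proof.
move=> B0 d0 x1; rewrite ler_pdivrMr ?exprn_gt0// => big.
have -> : expR (delta * x) = expR (delta * x / 2) ^+ 2.
  by rewrite -expRM_natl; congr expR; field.
have := expR_ge1Dx (delta * x / 2).
set e := expR _ => le_e.
have dx : 0 <= delta * x / 2 by rewrite divr_ge0// mulr_ge0//; lra.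
have : (delta * x / 2) ^+ 2 <= e ^+ 2.
  by apply: lerXn2r; rewrite ?nnegrE ?expR_ge0//; lra.
apply: le_trans; rewrite expr2.
have : x * (16 * (B + 1)) <= x * (x * delta ^+ 2).
  by apply: ler_wpM2l => //; lra.
lra.
Qed.

Lemma not_consistent (T V : nat -> nat) (Delta h : nat -> R)
    (psi : forall N, test R (T N) N) (s : R) : 0 < s ->
  (forall lam : R, 1 <= lam -> \forall N \near \oo,
    1 / 2 <= lam * total_error (psi N) (Delta N) (V N) (h N) +
             2 * lam `^ (- s)) ->
  ~ (total_error (psi N) (Delta N) (V N) (h N) @[N --> \oo] --> (0 : R)).
Proof.
move=> s0 low cvg0.
(* This choice makes 2 lam ^ - s equal to 1 / 4. *)
pose lam : R := 8 `^ s^-1.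
have lam1 : 1 <= lam.
  apply: (@le_trans _ _ (8 `^ 0)); first by rewrite powRr0.
  by apply: ler_powR; [lra|rewrite invr_ge0 ltW].
have lam8 : lam `^ (- s) = 8^-1.
  by rewrite /lam -powRrM mulrN mulVf ?gt_eqF// powR_inv1.
have lam0 : 0 < lam by exact: lt_le_trans lam1.
have small : 0 < 1 / (8 * lam) by rewrite divr_gt0// mulr_gt0.
have /cvgrPdist_le/(_ _ small) te0 := cvg0.
have : \forall N \near \oo, False.
  near=> N.
  have lowN : 1 / 2 <= lam * total_error (psi N) (Delta N) (V N) (h N) +
      2 * lam `^ (- s) by near: N; exact: low.
  have : `|0 - total_error (psi N) (Delta N) (V N) (h N)| <= 1 / (8 * lam).
    by near: N.
  rewrite sub0r normrN => /(le_trans (ler_norm _)).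
  rewrite ler_pdivlMr ?mulr_gt0// => te8.
  by move: lowN; rewrite lam8; lra.
by move=> /(@filter_ex _ _ _ _)[].
Unshelve. all: by end_near. Qed.

(** At rho = rho_Z the maximum over s in ]0, 1] of (1 + s) (beta - rho s) is
1 - zeta, and replacing rho by (1 - eps) rho makes it strictly larger. Put
u ^ 2 = 1 - zeta and w ^ 2 = 1 - zeta - beta, so that beta = u ^ 2 - w ^ 2. On
the second branch rho = (u - w) ^ 2 and the maximum is at s = w / (u - w),
which is at most 1 exactly when beta >= 3 (1 - zeta) / 4; on the first branch
s = 1 is optimal. *)
Lemma rho_Z_exponent (beta zeta eps : R) :
  0 < zeta < 1 -> 0 < eps < 1 -> (1 - zeta) / 2 < beta < 1 - zeta ->
  exists s : R, [/\ 0 < s <= 1, 0 < rho_Z beta zeta &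
    0 < (1 + s) * (beta - (1 - eps) * rho_Z beta zeta * s) - (1 - zeta)].
Proof.
move=> /andP[z0 z1] /andP[e0 e1] /andP[b1 b2]; rewrite /rho_Z.
case: ifPn => [_|]; last rewrite -ltNge => b3.
  by exists 1; rewrite ltr01 lexx; split=> //; [lra|nra].
set u := Num.sqrt _; set w := Num.sqrt _.
have u0 : 0 < u by rewrite sqrtr_gt0; lra.
have w0 : 0 < w by rewrite sqrtr_gt0; lra.
have uu : u * u = 1 - zeta by rewrite -expr2 sqr_sqrtr//; lra.
have ww : w * w = 1 - zeta - beta by rewrite -expr2 sqr_sqrtr//; lra.
have w2u : 2 * w <= u by nra.
have uw : 0 < u - w by lra.
have bE : beta = u * u - w * w by rewrite uu ww; ring.
exists (w / (u - w)); split.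
- by rewrite divr_gt0//= ler_pdivrMr// mul1r; lra.
- by rewrite exprn_gt0.
rewrite -uu bE.
have -> : (1 + w / (u - w)) * (u * u - w * w - (1 - eps) * (u - w) ^+ 2 *
    (w / (u - w))) - u * u = eps * (u * w).
  by field; rewrite gt_eqF.
by rewrite !mulr_gt0.
Qed.

Lemma undetectable (T V : nat -> nat) (Delta h : nat -> R)
    (zeta eps D0 eta : R) (psi : forall N, test R (T N) N) :
  0 < zeta < 1 -> 0 < eps < 1 -> 0 < D0 -> 0 <= eta < 1 / 2 ->
  T @ \oo --> \oo ->
  asymp_equiv (fun N => ln (T N)%:R) (fun N => N%:R `^ zeta) ->
  (forall N, (0 < V N)%N) ->
  (forall N, Delta N = D0 * (T N)%:R `^ (- eta)) ->
  ((fun N => (V N)%:R : R) =o_\oo (fun N => ln (T N)%:R / ln N%:R) /\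
     (forall N, h N = 4 * (1 - 2 * eta) * (1 - eps) *
        (ln (T N)%:R / (Delta N ^+ 2 * (V N)%:R))))
  \/ (exists beta : R,
       [/\ (1 - zeta) / 2 < beta < 1 - zeta,
           asymp_equiv (fun N => (V N)%:R) (fun N => N%:R `^ (1 - beta)) &
           forall N, h N = 4 * (1 - eps) * rho_Z beta zeta *
             (ln N%:R / Delta N ^+ 2)]) ->
  ~ (total_error (psi N) (Delta N) (V N) (h N) @[N --> \oo] --> (0 : R)).
Proof.
move=> zeta01 eps01 D00 eta01 Too Tzeta V0 DeltaE cases.
have [z0 z1] := andP zeta01; have [e0 e1] := andP eps01.
have [eta0 eta1] := andP eta01.
have T0 : \forall N \near \oo, (0 < T N)%N.
  exact: (Too _ (nbhs_infty_gt 0)).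
have tau_near := near_asymp_equiv (near_powR_gt0 zeta) Tzeta.
have tau_big (M : R) : \forall N \near \oo, M <= ln (T N)%:R.
  near=> N; have [lo _] : N%:R `^ zeta <= 2 * ln (T N)%:R /\
    ln (T N)%:R <= 2 * N%:R `^ zeta by near: N.
  have : 2 * M <= N%:R `^ zeta by near: N; exact: (near_le_powR _ z0).
  lra.
have growth (B delta : R) : 0 <= B -> 0 < delta -> \forall N \near \oo,
    4 * (B * ln (T N)%:R + 1) <= expR (delta * ln (T N)%:R).
  move=> B0 d0; near=> N; apply: linear_le_expR => //; near: N; exact: tau_big.
have DeltaX N : (0 < T N)%N ->
    Delta N = D0 * expR (- (eta * ln (T N)%:R)).
  move=> TN; rewrite DeltaE; congr (_ * _).
  by rewrite /powR gt_eqF ?mulNr// ltr0n.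
case: cases => [[Vo hE]|[beta [b12 Vb hE]]].
- pose s := eps / 2; have s0 : 0 < s by rewrite /s; lra.
  apply: (@not_consistent _ _ _ _ _ s) => // lam lam1.
  pose e := Num.min (1 / 4) (s ^+ 2 * (1 - 2 * eta) / 2 / (1 + D0 ^+ 2)).
  have D1 : 0 < 1 + D0 ^+ 2 by rewrite addr_gt0// exprn_gt0.
  have ssq : 0 < s ^+ 2 * (1 - 2 * eta) / 2.
    by rewrite divr_gt0// mulr_gt0 ?exprn_gt0//; lra.
  have ee0 : 0 < e by rewrite lt_min; apply/andP; split; [lra|exact: divr_gt0].
  have /eqoP/(_ _ ee0) Vsmall := Vo.
  near=> N.
  have TN : (0 < T N)%N by near: N.
  have tau1 : 1 <= ln (T N)%:R :> R by near: N; exact: tau_big.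
  have [tlo thi] : N%:R `^ zeta <= 2 * ln (T N)%:R /\
    ln (T N)%:R <= 2 * N%:R `^ zeta by near: N.
  have N0 : 0 < N%:R :> R by rewrite ltr0n; near: N; exact: nbhs_infty_gt.
  have lnN1 : 1 <= ln N%:R :> R.
    rewrite -[leLHS]expRK ler_ln ?posrE ?expR_gt0//.
    by apply: ltW; near: N; exact: nbhs_infty_gtr.
  have Ve : (V N)%:R <= e * ln (T N)%:R.
    have : `|(V N)%:R : R| <= e * `|ln (T N)%:R / ln N%:R| by near: N.
    rewrite normr_nat => /le_trans; apply.
    rewrite ler_pM2l// normf_div !ger0_norm; [|lra|lra].
    by rewrite ler_pdivrMr ?ler_peMr//; lra.
  rewrite (DeltaX _ TN); apply: sparse_undetectable => //.
  + rewrite -(ler_nat R); apply: le_trans Ve _.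
    have : N%:R `^ zeta <= N%:R.
      rewrite -[leRHS]powRr1 ?ler0n//; apply: ler_powR; last exact: ltW.
      by rewrite ler1n -(ltr0n R).
    have : e <= 1 / 4 by rewrite ge_min lexx.
    nra.
  + by rewrite hE -(DeltaX _ TN).
  + near: N; apply: growth; first by rewrite divr_ge0// sqr_ge0.
    by rewrite divr_gt0// mulr_gt0//; lra.
  + have := ler_wpM2r (ltW D1) Ve => /le_trans; apply.
    have eD : e * (1 + D0 ^+ 2) <= s ^+ 2 * (1 - 2 * eta) / 2.
      by rewrite -ler_pdivlMr// ge_min lexx orbT.
    have tau0 : 0 <= ln (T N)%:R :> R by lra.
    by have := ler_wpM2r tau0 eD; rewrite mulrAC.
- have [s [s01 rho0 kappa0]] := rho_Z_exponent zeta01 eps01 b12.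
  have [s0 s1] := andP s01; have [b1 b2] := andP b12.
  have beta0 : 0 < beta by lra.
  apply: (@not_consistent _ _ _ _ _ s) => // lam lam1.
  near=> N.
  have TN : (0 < T N)%N by near: N.
  have NN : (0 < N)%N by near: N; exact: nbhs_infty_gt.
  have [tlo thi] : N%:R `^ zeta <= 2 * ln (T N)%:R /\
    ln (T N)%:R <= 2 * N%:R `^ zeta by near: N.
  have [_ Vhi] : N%:R `^ (1 - beta) <= 2 * (V N)%:R /\
      (V N)%:R <= 2 * N%:R `^ (1 - beta) :> R.
    by near: N; exact: near_asymp_equiv (near_powR_gt0 _) Vb.
  rewrite (DeltaX _ TN).
  apply: (@moderate_undetectable _ _ _ _ _ _ _ eps _ TN (V0 N) D00 eta01 eps01
    lam1 _ (rho_Z beta zeta) s beta zeta) => //.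
  + by rewrite hE -(DeltaX _ TN).
  + have : ln N%:R <= 1 / 2 * N%:R `^ zeta.
      by near: N; apply: near_ln_le => //; lra.
    lra.
  + near: N; apply: growth; last by lra.
    by rewrite divr_ge0 ?mulr_ge0 ?sqr_ge0// ltW.
  + rewrite -(ler_nat R) natrM.
    have Nbeta : 8 <= N%:R `^ beta by near: N; exact: (near_le_powR _ beta0).
    have NE : N%:R = N%:R `^ (1 - beta) * N%:R `^ beta :> R.
      rewrite -powRD; last first.
        by rewrite (gt_eqF (_ : 0 < N%:R)) ?implybT// ltr0n.
      by rewrite subrK powRr1.
    have := ler_wpM2l (powR_ge0 N%:R (1 - beta)) Nbeta; rewrite -NE; lra.
  + rewrite -ler_pdivrMl; last by rewrite divr_gt0// mulr_gt0//; lra.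
    by near: N; exact: (near_le_powR _ kappa0).
Unshelve. all: by end_near. Qed.

End asymptotic.

Unset Implicit Arguments.

Theorem theorem2 (R : realType) (T V : nat -> nat) (Delta h : nat -> R)
    (zeta eps : R) :
  0 < zeta < 1 -> 0 < eps < 1 ->
  T @ \oo --> \oo ->
  asymp_equiv (fun N => ln (T N)%:R) (fun N => N%:R `^ zeta) ->
  (forall N, (0 < V N)%N) ->
  (exists Delta0 : R, [/\ 0 < Delta0, forall N, Delta N = Delta0 &
      ((fun N => (V N)%:R : R) =o_\oo (fun N => ln (T N)%:R / ln N%:R) /\
       (forall N, h N = 4 * (1 - eps) *
          (ln (T N)%:R / (Delta N ^+ 2 * (V N)%:R))))
      \/
      (exists beta : R,
        [/\ (1 - zeta) / 2 < beta < 1 - zeta,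
            asymp_equiv (fun N => (V N)%:R) (fun N => N%:R `^ (1 - beta)) &
            forall N, h N = 4 * (1 - eps) * rho_Z beta zeta *
              (ln N%:R / Delta N ^+ 2)]) ])
  \/
  (exists eta : R, [/\ 0 < eta < 1 / 2,
      forall N, Delta N = (T N)%:R `^ (- eta) &
      ((fun N => (V N)%:R : R) =o_\oo (fun N => ln (T N)%:R / ln N%:R) /\
       (forall N, h N = 4 * (1 - 2 * eta) * (1 - eps) *
          (ln (T N)%:R / (Delta N ^+ 2 * (V N)%:R))))
      \/
      (exists beta : R,
        [/\ (1 - zeta) / 2 < beta < 1 - zeta,
            asymp_equiv (fun N => (V N)%:R) (fun N => N%:R `^ (1 - beta)) &
            forall N, h N = 4 * (1 - eps) * rho_Z beta zeta *
              (ln N%:R / Delta N ^+ 2)]) ]) ->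
  ~ exists psi : forall N, test R (T N) N,
      (fun N => total_error (psi N) (Delta N) (V N) (h N)) @ \oo --> (0 : R).
Proof.
move=> zeta01 eps01 Too Tzeta V0 regimes [psi]; move: regimes.
case=> [[D0 [D00 DeltaE cases]]|[eta [/andP[eta0 eta1] DeltaE cases]]].
- apply: (@undetectable R T V Delta h zeta eps D0 0) => //.
  + by rewrite lexx divr_gt0.
  + by move=> N; rewrite oppr0 powRr0 mulr1.
  + by rewrite mulr0 subr0 mulr1.
- apply: (@undetectable R T V Delta h zeta eps 1 eta) => //.
  + by rewrite ltW.
  + by move=> N; rewrite mul1r.
Qed.
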